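(* Fix $\nu$. Suppose the error assumptions (E1)–(E5) and (E7) and the regressor condition (R) hold, the coefficients decay geometrically, i.e. $\max_{\ell}\max_{\nu'}\|\mathbf c_j^{(\ell,\nu')}\|_\infty=O(\rho^j)$ for some $0\le\rho<1$, and $|x_{tj}\epsilon_t^{(\nu')}|\le1$ for all $t$, $j=1,\dots,p$ and $\nu'\ge1$. Then $\widehat{\boldsymbol\beta}_{T\nu}\to\boldsymbol\beta_\nu$ in probability as $T,p\to\infty$, provided $p\log(p)/T=o(1)$ and $\log^2(T)/\sqrt p=o(1)$.
   Context: Setting: $p=p_T$ may grow with $T$. Regressors $\mathbf x_t\in\mathbb R^p$, spatial locations $\mathbf s_t\in[0,1]^q$, responses $Y_t^{(\nu)}=\mathbf x_t^\top\boldsymbol\beta_\nu+\epsilon_t^{(\nu)}$, $\nu=1,\dots,d$, $t=1,\dots,T$. $\mathbb P$ is conditional on the regressors. $\mathbb X_T=(\mathbf x_1,\dots,\mathbf x_T)^\top$ full rank, $\widehat{\boldsymbol\beta}_{T\nu}=(\mathbb X_T^\top\mathbb X_T)^{-1}\mathbb X_T^\top(Y_1^{(\nu)},\dots,Y_T^{(\nu)})^\top$. (R): regressors bounded; there exist positive definite $\Sigma_{\mathbf x}$, $\eta\ge0$, $C<\infty$, compact interval $A\subset(0,\infty)$, independent of $T,p$, with $\|T^{-1}\sum_t\mathbf x_t\mathbf x_t^\top-\Sigma_{\mathbf x}\|_2\le Cp^\eta/\sqrt T$ and $\operatorname{spec}(T^{-1}\mathbb X_T^\top\mathbb X_T)\subset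 A$. Error model: $\boldsymbol\epsilon_t=\mathbf H(\mathbf U_t(\mathbf s_t),\dots,\mathbf U_{t-m}(\mathbf s_t))-\mathbb E\,\mathbf H(\mathbf U_t(\mathbf s_t),\dots,\mathbf U_{t-m}(\mathbf s_t))$, $m\in\mathbb N_0$ fixed, $\mathbf H=(H_1,\dots,H_d):\mathbb R^{d\times(m+1)}\to\mathbb R^d$; the $\nu$th coordinate of $\mathbf U_t(\mathbf s)$ is $\sum_{\ell=1}^L\phi_{\nu\ell}d(\mathbf s,\mathbf r_\ell)F_t^{(\ell,\nu)}+E_t^{(\nu)}$ with fixed $L$, real $\phi_{\nu\ell}$, sites $\mathbf r_\ell\in[0,1]^q$, a function $d:[0,1]^q\times[0,1]^q\to[0,1]$, $\mathbf F_t^{(\ell)}=\sum_{j\ge0}\mathbb C_j^{(\ell)}\boldsymbol\varepsilon_{t-j}^{(\ell)}$, $\mathbf E_t=\sum_{j\ge0}\mathbb C_j^{(0)}\boldsymbol\varepsilon_{t-j}^{(0)}$, $d\times d$ matrices $\mathbb C_j^{(\ell)}$ with rows $\mathbf c_j^{(\ell,\nu)\top}$; $\varepsilon_t^{(\ell,\nu)}$ is the $\nu$th coordinate of $\boldsymbol\varepsilon_t^{(\ell)}$. (E1) $\{\boldsymbol\varepsilon_t^{(\ell)}\}_t$, $\ell=0,\dots,L$, mutually independent sequences of independent mean zero vectors $\boldsymbol\varepsilon_t^{(\ell)}=\Sigma_{\varepsilon,t}^{(\ell)1/2}\mathbf u_t^{(\ell)}$, $\Sigma_{\varepsilon,t}^{(\ell)}$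 symmetric positive definite, $\mathbf u_t^{(\ell)}$ mean zero with independent coordinates. (E2) $\sup_t\max_\ell\max_\nu\mathbb E|\varepsilon_t^{(\ell,\nu)}|^{2+\delta}<\infty$ for some $\delta>0$. (E3) If $d=1$: $\sup_t\max_\ell\mathbb E(\varepsilon_t^{(\ell)})^2<\infty$. (E4) If $d=1$: $\mathbb E(\varepsilon_t^{(0)})^2\ge\underline\sigma_0^2>0$; if $d>1$: $\lambda_{\min}(\Sigma_{\varepsilon,t}^{(0)})\ge\underline\lambda>0$. (E5) $\varepsilon_t^{(\ell,\nu)}$ has density $p_t^{(\ell,\nu)}$ with $\sup_t\int|p_t^{(\ell,\nu)}(z+x)-p_t^{(\ell,\nu)}(z)|dz=O(|x|)$. (E7) each $H_\nu$ is $L_H$-Lipschitz w.r.t. the Frobenius norm, and some random $d\times(m+1)$ matrix $\Xi$ independent of $\{\mathbf U_t\}$ has $\sup_\nu\mathbb E|H_\nu(\Xi)|^{2+\delta}<\infty$. *)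

(* Defs.v *)
From HB Require Import structures.
From mathcomp Require Import all_boot all_order all_algebra.
From mathcomp Require Import all_classical all_reals all_analysis.
Set Implicit Arguments. Unset Strict Implicit. Unset Printing Implicit Defensive.
Import Order.TTheory GRing.Theory Num.Theory.
Import numFieldNormedType.Exports.
Local Open Scope classical_set_scope.
Local Open Scope ring_scope.

Definition norm2 {R : realType} {n : nat} (v : 'cV[R]_n) : R :=
  Num.sqrt (\sum_(i < n) v i 0 ^+ 2).

Definition frob {R : realType} {m n : nat} (A : 'M[R]_(m, n)) : R :=
  Num.sqrt (\sum_(i < m) \sum_(j < n) A i j ^+ 2).

Definition spec_norm_le {R : realType} {n : nat} (M : 'M[R]_n) (K : R) : Prop :=
  forall v : 'cV[R]_n, norm2 (M *m v) <= K * norm2 v.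

Definition symmetric_mx {R : realType} {n : nat} (M : 'M[R]_n) : Prop := M^T = M.

Definition posdef {R : realType} {n : nat} (M : 'M[R]_n) : Prop :=
  symmetric_mx M /\ forall v : 'cV[R]_n, v != 0 -> 0 < (v^T *m M *m v) 0 0.

Definition mutually_indep_vecs {dsp} {T : measurableType dsp} {R : realType}
  (P : probability T R) {I : Type} {k : nat} (X : I -> 'I_k -> T -> R) : Prop :=
  forall (n : nat) (f : 'I_n -> I), injective f ->
  forall B : 'I_n -> 'I_k -> set R, (forall i j, measurable (B i j)) ->
  P (\bigcap_(i in [set: 'I_n]) \bigcap_(j in [set: 'I_k]) (X (f i) j @^-1` B i j))
  = (\prod_(i < n) P (\bigcap_(j in [set: 'I_k]) (X (f i) j @^-1` B i j)))%E.

Definition indep_coords {dsp} {T : measurableType dsp} {R : realType}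
  (P : probability T R) {k : nat} (X : 'I_k -> T -> R) : Prop :=
  forall B : 'I_k -> set R, (forall j, measurable (B j)) ->
  P (\bigcap_(j in [set: 'I_k]) (X j @^-1` B j)) = (\prod_(j < k) P (X j @^-1` B j))%E.

Definition indep_of_family {dsp} {T : measurableType dsp} {R : realType}
  (P : probability T R) {K : finType} {I : Type} (X : K -> T -> R) (Y : I -> T -> R) : Prop :=
  forall (B : K -> set R), (forall k, measurable (B k)) ->
  forall (n : nat) (f : 'I_n -> I) (C : 'I_n -> set R), (forall i, measurable (C i)) ->
  P ((\bigcap_(k in [set: K]) (X k @^-1` B k)) `&` (\bigcap_(i in [set: 'I_n]) (Y (f i) @^-1` C i)))
  = (P (\bigcap_(k in [set: K]) (X k @^-1` B k)) * P (\bigcap_(i in [set: 'I_n]) (Y (f i) @^-1` C i)))%E.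

Section model.
Context {dsp} {T : measurableType dsp} {R : realType} (P : probability T R).
Context (d q m L : nat).
(* innovations eps ℓ t ν, ℓ = 0..L, t : int, ν : coordinate *)
Context (eps : 'I_L.+1 -> int -> 'I_d -> T -> R).
(* coefficient matrices C j ℓ (d x d); rows are c_j^(ℓ,ν) *)
Context (C : nat -> 'I_L.+1 -> 'M[R]_d).

(* F_t^(ℓ) = sum_{j>=0} C_j^(ℓ) eps_{t-j}^(ℓ) (pointwise limit of partial sums);
   ℓ = 0 gives E_t *)
Definition MAproc (l : 'I_L.+1) (t : int) (nu : 'I_d) (w : T) : R :=
  limn (fun N : nat => \sum_(j < N) \sum_(k < d) C j l nu k * eps l (t - j%:Z) k w).

Context (phi : 'I_d -> 'I_L -> R) (r : 'I_L -> ('I_q -> R))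
        (dist : ('I_q -> R) -> ('I_q -> R) -> R).

Definition Ufield (t : int) (s : 'I_q -> R) (nu : 'I_d) (w : T) : R :=
  \sum_(l < L) phi nu l * dist s (r l) * MAproc (lift ord0 l) t nu w
  + MAproc ord0 t nu w.

Context (H : 'I_d -> 'M[R]_(d, m.+1) -> R) (s : nat -> ('I_q -> R)).

Definition Umat (t : nat) (w : T) : 'M[R]_(d, m.+1) :=
  \matrix_(i < d, k < m.+1) Ufield (t%:Z - k%:Z) (s t) i w.

Definition errobs (t : nat) (nu : 'I_d) (w : T) : R :=
  H nu (Umat t w) - fine ('E_P[fun w' => H nu (Umat t w')])%E.

End model.

Definition ols {R : realType} {n p : nat} (X : 'M[R]_(n, p)) (Y : 'cV[R]_n) : 'cV[R]_p :=
  invmx (X^T *m X) *m X^T *m Y.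

(* Main.v *)
Require Import Defs.
From HB Require Import structures.
From mathcomp Require Import all_boot all_order all_algebra.
From mathcomp Require Import all_classical all_reals all_analysis.
From mathcomp Require Import measurable_realfun ring lra zify.
Import Order.TTheory GRing.Theory Num.Theory.
Import numFieldNormedType.Exports.
Local Open Scope classical_set_scope.
Local Open Scope ring_scope.

(* Second moment method. With [G = X^T X], the estimation error is
   [G^-1 X^T err], so by the Rayleigh bound [v^T G v >= a T |v|^2] its squared
   norm is at most [(a T)^-2 |X^T err|^2], whose mean is
   [(a T)^-2 \sum_(s, t) (X X^T)_st cov(err_s, err_t)].  Truncating the
   moving averages at lag [n] changes [H (U_t)] by [O(rho^n)] in [L^2], and
   truncated errors at distance [n + m] are independent; hence the covariances
   decay geometrically in [|s - t|], the mean is [O(p / T)], and Markov's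
   inequality concludes. *)

Set Implicit Arguments.
Unset Strict Implicit.
Unset Printing Implicit Defensive.

(** * Least squares and the Rayleigh quotient *)

(** The design is controlled only through its eigenvalues, so the Rayleigh bound requires the
    infimum [l] of the Rayleigh quotient to be an eigenvalue itself. If it were not, [S - l%:M]
    would be invertible and positive semidefinite, hence coercive, and the infimum could be raised.
    The moving averages are pointwise values of [limn], which is defined even where the series
    diverges. The truncation error is therefore bounded at every sample point by an extended real
    series, which is infinite wherever the moving average diverges, and only then integrated; almost
    sure convergence never has to be discussed. Square integrability of [H (U_t)] comes from the
    same estimate: truncation at lag 0 leaves the constant [H 0]. The order of the mean arises as
    follows: entries of [X X^T] are O(p), each row of covariances is summable uniformly in T, so T
    rows give O(p T), to be divided by [(a T)^2]. Finally p / T tends to 0 because p is at most a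
    constant plus p log p. *)

Lemma quad_formE (R : realType) n (M : 'M[R]_n) (v w : 'cV[R]_n) :
  (v^T *m M *m w) 0 0 = \sum_i \sum_j v i 0 * M i j * w j 0.
Proof.
rewrite mxE exchange_big /=; apply: eq_bigr => j _.
rewrite mxE mulr_suml; apply: eq_bigr => i _; by rewrite !mxE.
Qed.

Lemma dot_mxE (R : realType) n (v w : 'cV[R]_n) :
  (v^T *m w) 0 0 = \sum_i v i 0 * w i 0.
Proof. by rewrite mxE; apply: eq_bigr => i _; rewrite mxE. Qed.

Lemma dot_mx_ge0 (R : realType) n (v : 'cV[R]_n) : 0 <= (v^T *m v) 0 0.
Proof. by rewrite dot_mxE sumr_ge0// => i _; rewrite -expr2 sqr_ge0. Qed.

Lemma dot_mx_gt0 (R : realType) n (v : 'cV[R]_n) : v != 0 -> 0 < (v^T *m v) 0 0.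
Proof.
move=> v0; rewrite lt_neqAle dot_mx_ge0 andbT eq_sym; apply: contra v0 => /eqP.
rewrite dot_mxE => /eqP; rewrite psumr_eq0; last first.
  by move=> i _; rewrite -expr2 sqr_ge0.
move=> /allP h; apply/eqP/matrixP => i j; rewrite ord1 mxE.
by have := h i (mem_index_enum _); rewrite -expr2 sqrf_eq0 => /eqP.
Qed.

Lemma norm2_sqr (R : realType) n (v : 'cV[R]_n) : norm2 v ^+ 2 = (v^T *m v) 0 0.
Proof.
rewrite dot_mxE sqr_sqrtr; last by rewrite sumr_ge0// => i _; rewrite sqr_ge0.
by apply: eq_bigr => i _; rewrite expr2.
Qed.

(** Each product of two coordinates of [v] is at most the squared norm of [v], so the sum of the
    absolute entries serves as a bound; the added 1 only makes it positive. *)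
Lemma quad_form_bound (R : realType) n (M : 'M[R]_n) :
  exists2 K : R, 0 < K & forall v : 'cV_n, (v^T *m M *m v) 0 0 <= K * (v^T *m v) 0 0.
Proof.
exists (1 + \sum_i \sum_j `|M i j|).
  by rewrite ltr_wpDr// sumr_ge0// => i _; rewrite sumr_ge0.
move=> v; rewrite quad_formE mulrDl mul1r ler_wpDl ?dot_mx_ge0//.
have sq i : v i 0 ^+ 2 <= (v^T *m v) 0 0.
  rewrite dot_mxE (bigD1 i)//= -expr2 lerDl sumr_ge0// => k _.
  by rewrite -expr2 sqr_ge0.
rewrite mulr_suml; apply: ler_sum => i _; rewrite mulr_suml; apply: ler_sum => j _.
apply: le_trans (ler_norm _) _.
rewrite (mulrC (v i 0)) -mulrA normrM ler_wpM2l//.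
have := sq i; have := sq j; move: (_ 0 0) (v i 0) (v j 0) => Q x y hx hy.
by rewrite ler_norml; apply/andP; split; nra.
Qed.

(* For a positive semidefinite [M], expanding the form at [v - K^-1 M v] gives
   [|M v|^2 <= K v^T M v]. *)
Lemma psd_unit_coercive (R : realType) n (M : 'M[R]_n) :
  M^T = M -> M \in unitmx -> (forall v : 'cV_n, 0 <= (v^T *m M *m v) 0 0) ->
  exists2 c : R, 0 < c & forall v : 'cV_n, c * (v^T *m v) 0 0 <= (v^T *m M *m v) 0 0.
Proof.
move=> symM uM psd.
have [K K0 hK] := quad_form_bound M.
have [K' K'0 hK'] := quad_form_bound ((invmx M)^T *m invmx M).
exists (K * K')^-1; first by rewrite invr_gt0 mulr_gt0.
move=> v; rewrite mulrC ler_pdivrMr ?mulr_gt0//.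
set w := M *m v.
(* Invertibility enters here: [v] is the image of [w] under the inverse of [M], whose operator bound
   is [K']. *)
have vw : (v^T *m v) 0 0 <= K' * (w^T *m w) 0 0.
  have vE : v = invmx M *m w by rewrite /w mulKmx.
  by apply: le_trans (hK' w); rewrite {1 2}vE trmx_mul !mulmxA.
have wq : (w^T *m w) 0 0 <= K * (v^T *m M *m v) 0 0.
  have := psd (v - K^-1 *: w).
  have -> : ((v - K^-1 *: w)^T *m M *m (v - K^-1 *: w)) 0 0
     = (v^T *m M *m v) 0 0 - 2 * K^-1 * (w^T *m w) 0 0
        + K^-1 ^+ 2 * (w^T *m M *m w) 0 0.
    have e1 : (v^T *m M *m w) 0 0 = (w^T *m w) 0 0.
      by rewrite [in RHS]/w trmx_mul symM.
    have e2 : (w^T *m M *m v) 0 0 = (w^T *m w) 0 0.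
      by rewrite -mulmxA.
    rewrite [(_ - _)^T]linearB /= mulmxBl mulmxBr !mulmxBl.
    rewrite linearZ /= -!scalemxAr -!scalemxAl.
    rewrite !mxE in e1 e2 *.
    by rewrite e1 e2; ring.
  have := hK w; move: ((w^T *m M *m w) 0 0) ((w^T *m w) 0 0) ((v^T *m M *m v) 0 0) => a b c ab h.
  have KV : K^-1 ^+ 2 * a <= K^-1 * b.
    by rewrite expr2 -mulrA ler_pM2l ?invr_gt0// ler_pdivrMl.
  have : 0 <= c - K^-1 * b by lra.
  by rewrite subr_ge0 mulrC ler_pdivrMr// mulrC.
apply: le_trans vw _.
by rewrite mulrA [X in _ <= X]mulrC ler_pM2l// mulrC.
Qed.

(** The infimum of the Rayleigh quotient is an eigenvalue, hence at least [a]. No minimizing vector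
    is constructed: the argument is by contradiction, through coercivity of the shifted matrix. *)
Lemma rayleigh_ge (R : realType) n (S : 'M[R]_n) (a : R) :
  S^T = S -> (forall v : 'cV_n, 0 <= (v^T *m S *m v) 0 0) ->
  (forall l, eigenvalue S l -> a <= l) ->
  forall v : 'cV_n, a * (v^T *m v) 0 0 <= (v^T *m S *m v) 0 0.
Proof.
move=> symS psd eig v.
have [->|v0] := eqVneq v 0.
  by rewrite !mulmx0 !mxE mulr0.
pose Q := [set x | exists2 u : 'cV[R]_n, u != 0 &
  x = (u^T *m S *m u) 0 0 / (u^T *m u) 0 0].
have hQ : has_inf Q.
  split; first by exists ((v^T *m S *m v) 0 0 / (v^T *m v) 0 0), v.
  by exists 0 => _ [u u0 ->]; rewrite divr_ge0 ?dot_mx_ge0.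
pose l := inf Q.
have lq (u : 'cV[R]_n) : l * (u^T *m u) 0 0 <= (u^T *m S *m u) 0 0.
  have [->|u0] := eqVneq u 0; first by rewrite !mulmx0 !mxE mulr0.
  rewrite -ler_pdivlMr ?dot_mx_gt0//; have lb := ge_inf hQ.2; apply: lb.
  by exists u.
apply: le_trans (lq v); rewrite ler_wpM2r ?dot_mx_ge0//; apply: eig.
apply: contrapT => nl.
pose M := S - l%:M.
have ME (u : 'cV[R]_n) : (u^T *m M *m u) 0 0 = (u^T *m S *m u) 0 0 - l * (u^T *m u) 0 0.
  rewrite mulmxBr mulmxBl mul_mx_scalar -scalemxAl.
  by rewrite mxE [X in _ + X]mxE [X in _ - X]mxE.
have uM : M \in unitmx.
  rewrite -row_free_unit -kermx_eq0; apply: contrapT => /negP h.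
  by apply: nl.
have symM : M^T = M by rewrite linearB /= symS tr_scalar_mx.
have psdM (u : 'cV[R]_n) : 0 <= (u^T *m M *m u) 0 0 by rewrite ME subr_ge0.
have [c c0 hc] := psd_unit_coercive symM uM psdM.
(* Coercivity of [S - l%:M] keeps every Rayleigh quotient at or above [l + c], which contradicts the
   choice of [l]. *)
have : l + c <= l.
  apply: lb_le_inf; first exact: hQ.1.
  move=> _ [u u0 ->]; rewrite ler_pdivlMr ?dot_mx_gt0//.
  by have := hc u; rewrite ME; lra.
by rewrite gerDl leNgt c0.
Qed.

(** The error [D] solves the normal equation [X^T X D = z] with [z = X^T e]. The Rayleigh bound
    reads [k |D|^2 <= D . z] with [k = a T], and nonnegativity of [|z - k D|^2] replaces an appeal
    to Cauchy-Schwarz in deducing [k^2 |D|^2 <= |z|^2]. *)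
Lemma ols_error_bound (R : realType) (T p : nat) (X : 'M[R]_(T, p))
    (b : 'cV[R]_p) (e : 'cV[R]_T) (a : R) : (0 < T)%N -> 0 < a ->
  (forall l, eigenvalue (T%:R^-1 *: (X^T *m X)) l -> a <= l) ->
  norm2 (ols X (X *m b + e) - b) ^+ 2 <= (a * T%:R)^-2 * norm2 (X^T *m e) ^+ 2.
Proof.
move=> T0 a0 eig; have TR0 : 0 < (T%:R : R) by rewrite ltr0n.
set S := _ *: _ in eig.
have symS : S^T = S by rewrite /S linearZ /= trmx_mul trmxK.
have psdS (v : 'cV_p) : 0 <= (v^T *m S *m v) 0 0.
  rewrite /S -scalemxAr -scalemxAl mxE mulr_ge0 ?invr_ge0 ?ler0n//.
  have := dot_mx_ge0 (X *m v).
  by rewrite trmx_mul !mulmxA.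
have ray := rayleigh_ge symS psdS eig.
have uG : X^T *m X \in unitmx.
  have : S \in unitmx.
    rewrite -row_free_unit -kermx_eq0; apply: contrapT => /negP h.
    have : eigenvalue S 0 by rewrite /eigenvalue /eigenspace raddf0 subr0.
    by move/eig; rewrite leNgt a0.
  by rewrite unitmxZ ?unitfE ?invr_neq0 ?gt_eqF.
set D := _ - b.
have GD : X^T *m X *m D = X^T *m e.
  by rewrite /D /ols mulmxBr !mulmxA mulmxV// mul1mx mulmxDr !mulmxA addrAC subrr add0r.
clearbody D; have := ray D.
rewrite /S -scalemxAr -scalemxAl -[D^T *m _ *m D]mulmxA GD mxE !norm2_sqr.
set z := X^T *m e; set k := a * T%:R.
have k0 : 0 < k by rewrite mulr_gt0.
have : 0 <= ((z - k *: D)^T *m (z - k *: D)) 0 0 by exact: dot_mx_ge0.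
have e1 : (z^T *m D) 0 0 = (D^T *m z) 0 0.
  by rewrite !dot_mxE; apply: eq_bigr => i _; rewrite mulrC.
rewrite [(_ - _)^T]linearB /= mulmxBl !mulmxBr [(_ *: _)^T]linearZ /=.
rewrite -!scalemxAr -!scalemxAl !mxE in e1 *; rewrite e1.
move: (\sum_j _) (\sum_j _) (\sum_j _) => x y w h1 h2.
rewrite ler_pdivlMl ?exprn_gt0// expr2.
have : T%:R * (a * x) <= y by rewrite -ler_pdivlMl.
rewrite -(ler_pM2l k0).
by rewrite (_ : k * (T%:R * (a * x)) = k * k * x); [lra | rewrite /k; ring].
Qed.

(** * Measurability *)

(** By completeness, convergence is the Cauchy property, and tolerances of the form 1/(k+1) make it
    a countable combination of measurable sets. *)
Lemma measurable_set_cvgn d (T : measurableType d) (R : realType) (h : (T -> R)^nat) :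
  (forall n, measurable_fun setT (h n)) ->
  measurable [set w | cvgn (h ^~ w)].
Proof.
move=> mh.
have -> : [set w | cvgn (h ^~ w)] = \bigcap_k \bigcup_N \bigcap_n
    [set w | `|h (N + n)%N w - h N w| < k.+1%:R^-1].
  apply/seteqP; split => [w /cvg_ex[l hl] k _|w hw].
    have e0 : 0 < k.+1%:R^-1 / 2 :> R by rewrite divr_gt0// invr_gt0.
    have /cvgrPdist_lt/(_ _ e0)[N _ hN] := hl.
    exists N => // n _ /=.
    have := hN N (leqnn _); have := hN (N + n)%N (leq_addr _ _) => /=.
    move=> h1 h2; rewrite -(subrK l (h (N + n)%N w)) -addrA.
    apply: le_lt_trans (ler_normD _ _) _; rewrite distrC.
    by rewrite [ltRHS]splitr ltrD.
  apply/cauchy_cvgP; apply: cauchy_exP => e e0 /=.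
  have [k _ hk] : \forall k \near \oo, k.+1%:R^-1 < e.
    exact: near_infty_natSinv_lt (PosNum e0).
  have [N _ hN] := hw k I; exists (h N w), N => // n /= Nn.
  rewrite /ball /= distrC; apply: lt_trans (hk _ (leqnn _)).
  by have := hN (n - N)%N I; rewrite /= subnKC.
apply: bigcapT_measurable => k; apply: bigcup_measurable => N _.
apply: bigcapT_measurable => n.
have mf : measurable_fun setT (fun w => `|h (N + n)%N w - h N w|).
  by apply: measurableT_comp => //; exact: measurable_funB.
rewrite -[X in measurable X]setTI.
have := @measurable_fun_ltr _ _ _ setT _ _ mf (measurable_cst (k.+1%:R^-1 : R)).
by move/(_ measurableT [set true]) => /=; apply.
Qed.

(** Off the convergence set [limn] takes the default value [point], so the function is glued from a
    genuine pointwise limit and a constant. *)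
Lemma measurable_fun_limn d (T : measurableType d) (R : realType) (h : (T -> R)^nat) :
  (forall n, measurable_fun setT (h n)) ->
  measurable_fun setT (fun w => limn (h ^~ w)).
Proof.
move=> mh; have mD := measurable_set_cvgn mh.
set D := [set w | _] in mD.
have -> : (fun w => limn (h ^~ w)) = (fun w => if w \in D then limn (h ^~ w) else point).
  apply/funext => w; case: ifPn => //; rewrite notin_setE /D /= => /dvgP.
  by [].
rewrite -(setUv D); apply/measurable_funU => //; first exact: measurableC.
split.
  apply: (measurable_fun_cvg (h := h)).
    by move=> m; exact: measurable_funS (mh m).
  by move=> x Dx; rewrite mem_set.
apply: (eq_measurable_fun (cst point)).
  by move=> x; rewrite inE /= => nDx; rewrite memNset.
exact: measurable_cst.
Qed.

Lemma frob_sqr (R : realType) m n (A : 'M[R]_(m, n)) :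
  frob A ^+ 2 = \sum_i \sum_j A i j ^+ 2.
Proof. by rewrite sqr_sqrtr// sumr_ge0// => i _; rewrite sumr_ge0// => j _; rewrite sqr_ge0. Qed.

Lemma sumsqr_le_sqrsum (R : realType) (I : finType) (f : I -> R) :
  (forall i, 0 <= f i) -> \sum_i f i ^+ 2 <= (\sum_i f i) ^+ 2.
Proof.
move=> f0; rewrite expr2 mulr_suml; apply: ler_sum => i _.
by rewrite expr2 ler_wpM2l// (bigD1 i)//= lerDl sumr_ge0.
Qed.

Lemma frob_le_sum (R : realType) m n (A : 'M[R]_(m, n)) :
  frob A <= \sum_i \sum_j `|A i j|.
Proof.
have s0 : 0 <= \sum_i \sum_j `|A i j| by rewrite sumr_ge0// => i _; rewrite sumr_ge0.
rewrite -(@ler_pXn2r _ 2) ?nnegrE ?sqrtr_ge0// frob_sqr !pair_bigA /=.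
apply: le_trans (sumsqr_le_sqrsum _) => //.
by apply: ler_sum => i _; rewrite -normrX ger0_norm// sqr_ge0.
Qed.

(* [h (A w)] is the supremum over rational matrices [B] of
   [h B - K * |A w - B|_1], a countable supremum of measurable functions. *)
Lemma measurable_fun_lipschitz_mx d (T : measurableType d) (R : realType) m n
    (h : 'M[R]_(m, n) -> R) (K : R) (A : T -> 'M[R]_(m, n)) :
  (forall B B', `|h B - h B'| <= K * frob (B - B')) ->
  (forall i j, measurable_fun setT (fun w => A w i j)) ->
  measurable_fun setT (fun w => h (A w)).
Proof.
move=> hK mA.
pose l1 (B : 'M[R]_(m, n)) := \sum_i \sum_j `|B i j|.
have hl B B' : `|h B - h B'| <= `|K| * l1 (B - B').
  apply: le_trans (hK _ _) _; apply: le_trans (_ : `|K| * frob (B - B') <= _).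
    by rewrite ler_wpM2r ?sqrtr_ge0// ler_norm.
  by rewrite ler_wpM2l// frob_le_sum.
(* An enumeration of the rational matrices; indices that encode no matrix fall back to 0. *)
pose q k : 'M[R]_(m, n) := map_mx (@ratr R) (odflt (0 : 'M[rat]_(m, n)) (unpickle k)).
pose f k w := h (q k) - `|K| * l1 (A w - q k).
have fle k w : f k w <= h (A w).
  have := hl (q k) (A w); rewrite /f.
  rewrite [l1 (A w - _)](_ : _ = l1 (q k - A w)); last first.
    by apply: eq_bigr => i _; apply: eq_bigr => j _; rewrite !mxE distrC.
  by move=> /(le_trans (ler_norm _)); rewrite lerBlDr lerBlDr addrC.
have ub w : has_ubound (range (f ^~ w)) by exists (h (A w)) => _ [k _ <-].
have -> : (fun w => h (A w)) = (fun w => sups (f ^~ w) 0).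
  apply/funext => w; apply/eqP; rewrite eq_le; apply/andP; split; last first.
    apply: ge_sup; first by exists (f 0%N w), 0%N.
    by move=> _ [k _ <-].
  apply/ler_addgt0Pr => e e0.
  (* The error [|K| * l1] is paid twice, once in the definition of [f] and once by the Lipschitz
     bound, over [m * n] entries; the 1 guards against a zero denominator. *)
  pose e' := e / (2 * `|K| * (m * n)%:R + 1).
  have den0 : 0 < 2 * `|K| * (m * n)%:R + 1 by rewrite ltr_wpDl// !mulr_ge0.
  have e'0 : 0 < e' by rewrite divr_gt0.
  have ex i j : exists r : rat, `|A w i j - ratr r| <= e'.
    have : A w i j - e' < A w i j + e' by lra.
    move=> /rat_in_itvoo[r]; rewrite in_itv /= => /andP[r1 r2].
    by exists r; rewrite ler_norml; apply/andP; split; lra.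
  pose B := \matrix_(i < m, j < n) projT1 (cid (ex i j)).
  have qB : q (pickle B) = map_mx (@ratr R) B by rewrite /q pickleK.
  have lB : l1 (A w - q (pickle B)) <= (m * n)%:R * e'.
    rewrite qB /l1; apply: (@le_trans _ _ (\sum_(i < m) \sum_(j < n) e')).
      apply: ler_sum => i _; apply: ler_sum => j _; rewrite !mxE.
      by case: cid.
    by rewrite !sumr_const !card_ord -mulrnA mulr_natl mulnC.
  have fB : f (pickle B) w <= sups (f ^~ w) 0.
    by apply: ub_le_sup; [exact: has_ubound_sdrop | exists (pickle B)].
  have := hl (A w) (q (pickle B)) => /(le_trans (ler_norm _)) h1.
  have Kl : `|K| * l1 (A w - q (pickle B)) <= `|K| * ((m * n)%:R * e').
    by rewrite ler_wpM2l.
  have e'e : 2 * `|K| * (m * n)%:R * e' <= e.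
    have : (2 * `|K| * (m * n)%:R + 1) * e' = e by rewrite /e' mulrC divfK ?gt_eqF.
    by move: e'0; move: (2 * _ * _) => z; lra.
  move: fB h1 Kl e'e; rewrite /f -!mulrA.
  by move: (`|K| * _) (`|K| * _) => x y; lra.
apply: measurable_fun_sups => // k.
apply: measurable_funB; first exact: measurable_cst.
apply: measurable_funM; first exact: measurable_cst.
apply: measurable_sum => i; apply: measurable_sum => j.
apply: measurableT_comp => //.
under eq_fun do rewrite mxE [X in _ + X]mxE.
by apply: measurable_funB.
Qed.

(** * Independence *)

Section independence.
Context d (T : measurableType d) (R : realType) (P : probability T R).

Definition indep_systems (G1 G2 : set (set T)) :=
  forall A B, G1 A -> G2 B -> P (A `&` B) = (P A * P B)%E.

Lemma indep_systemsC G1 G2 : indep_systems G1 G2 -> indep_systems G2 G1.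
Proof. by move=> h A B GA GB; rewrite setIC muleC; exact: h. Qed.

(** Dynkin's argument: for a fixed [B], the events whose probability factors with that of [B] form a
    lambda-system, which contains the pi-system [G1] and hence the sigma-algebra it generates. *)
Lemma indep_systems_sigma G1 G2 : setI_closed G1 ->
  G1 `<=` measurable -> G2 `<=` measurable ->
  indep_systems G1 G2 -> indep_systems <<s G1 >> G2.
Proof.
move=> G1I mG1 mG2 ind A B + GB; move: A.
have mB := mG2 _ GB.
suff : <<s G1 >> `<=` [set A | measurable A /\ P (A `&` B) = (P A * P B)%E].
  by move=> h A /h[].
apply: lambda_system_subset => //; last by move=> A GA; split; [exact: mG1|exact: ind].
apply/dynkin_lambda_system; split => /=.
- by split => //; rewrite setTI probability_setT mul1e.
- move=> A [mA PA]; split; first exact: measurableC.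
  have -> : ~` A `&` B = B `\` (A `&` B).
    by rewrite setDE setCI setIUr setICr setU0 setIC.
  have fAB : (P (A `&` B) < +oo)%E by rewrite ltey_eq fin_num_measure//; exact: measurableI.
  rewrite measureD//; [|exact: measurableI| by rewrite ltey_eq fin_num_measure].
  rewrite (_ : B `&` (A `&` B) = A `&` B); last by rewrite setIC -setIA setIid.
  rewrite [X in (_ - X)%E]PA [P (~` A)]probability_setC//.
  have H (x y : \bar R) : x \is a fin_num -> y \is a fin_num -> (y - x * y = (1 - x) * y)%E.
    by case: x y => [x||] [y||] // _ _; rewrite -EFinM -!EFinB -EFinM mulrBl mul1r.
  by apply: H; exact: fin_num_measure.
- move=> F tF hF; have mF n : measurable (F n) := (hF n).1.
  split; first exact: bigcup_measurable.
  rewrite setI_bigcupl measure_bigcup//; last 2 first.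
    by move=> n _; exact: measurableI.
    exact: trivIset_setIr.
  transitivity (\sum_(n <oo) (P (F n) * P B))%E.
    under eq_eseriesl do rewrite in_setT.
    by apply: eq_eseriesr => n _; exact: (hF n).2.
  rewrite [P (\bigcup_k _)]measure_bigcup// -[P B]fineK ?fin_num_measure//.
  rewrite muleC -nneseriesZl//; under eq_eseriesr do rewrite muleC.
  by under [in RHS]eq_eseriesl do rewrite in_setT.
Qed.

Lemma indep_systems_sigma2 G1 G2 : setI_closed G1 -> setI_closed G2 ->
  G1 `<=` measurable -> G2 `<=` measurable ->
  indep_systems G1 G2 -> indep_systems <<s G1 >> <<s G2 >>.
Proof.
move=> G1I G2I mG1 mG2 ind.
have sG1 : <<s G1 >> `<=` measurable.
  by apply: smallest_sub => //; exact: sigma_algebra_measurable.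
apply: indep_systemsC; apply: indep_systems_sigma => //.
by apply: indep_systemsC; exact: indep_systems_sigma.
Qed.

Definition indep_rv (Y Z : T -> R) := forall A B, measurable A -> measurable B ->
  P ((Y @^-1` A) `&` (Z @^-1` B)) = (P (Y @^-1` A) * P (Z @^-1` B))%E.

(** Independence identifies the joint law of [(Y, Z)] with the product of the marginal laws, since
    the two agree on rectangles; Fubini then factors the integral of [z.1 * z.2]. *)
Lemma indep_rv_expectationM (Y Z : T -> R) : indep_rv Y Z ->
  Y \in Lfun P 1 -> Z \in Lfun P 1 -> (Y \* Z)%R \in Lfun P 1 ->
  ('E_P[(Y \* Z)%R] = 'E_P[Y] * 'E_P[Z])%E.
Proof.
move=> ind LY LZ LYZ.
have mY : measurable_fun setT Y by move: LY => /andP[/[!inE]].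
have mZ : measurable_fun setT Z by move: LZ => /andP[/[!inE]].
pose Yv : {RV P >-> R} := HB.pack Y (isMeasurableFun.Build _ _ _ _ Y mY).
pose Zv : {RV P >-> R} := HB.pack Z (isMeasurableFun.Build _ _ _ _ Z mZ).
have mW : measurable_fun setT (fun w => (Y w, Z w)) by exact: measurable_fun_pair.
pose Wv : {RV P >-> (R * R)%type} :=
  HB.pack (fun w => (Y w, Z w)) (isMeasurableFun.Build _ _ _ _ _ mW).
pose f (z : R * R) := (z.1 * z.2)%:E.
have mf : measurable_fun setT f.
  by apply/measurable_EFinP; apply: measurable_funM; [exact: measurable_fst|exact: measurable_snd].
have iYZ : P.-integrable setT (f \o Wv) by move/Lfun1_integrable : LYZ.
have iY : P.-integrable setT (EFin \o Y) by exact/Lfun1_integrable.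
have iZ : P.-integrable setT (EFin \o Z) by exact/Lfun1_integrable.
have prodE X : measurable X ->
   (distribution P Yv \x distribution P Zv)%E X = distribution P Wv X.
  apply: product_measure_unique => A B mA mB.
  by rewrite /distribution /pushforward /=; rewrite -ind.
have iff : (distribution P Yv \x distribution P Zv)%E.-integrable setT f.
  have := @integrable_pushforward _ _ _ _ _ _ mW P setT f mf.
  rewrite preimage_setT => /(_ iYZ measurableT) /integrableP[_ h].
  apply/integrableP; split => //; apply: le_lt_trans h.
  rewrite le_eqVlt; apply/orP; left; apply/eqP.
  apply: eq_measure_integral => A mA _; exact: prodE.
rewrite unlock.
have -> : (\int[P]_w ((Y \* Z) w)%:E = \int[distribution P Wv]_z f z)%E.
  rewrite integral_distribution//.
rewrite (eq_measure_integral (distribution P Yv \x distribution P Zv)%E); last first.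
  by move=> A mA _; apply/esym; exact: prodE.
rewrite -integral12_prod_meas1// /fubini_F /f /=.
have iEFin (V : {RV P >-> R}) : P.-integrable setT (EFin \o V) ->
    (distribution P V).-integrable setT EFin.
  move=> iV.
  have := @integrable_pushforward _ _ _ _ _ _ (measurable_funPT V) P setT EFin.
  by rewrite preimage_setT; apply.
have dE (V : {RV P >-> R}) : P.-integrable setT (EFin \o V) ->
    (\int[distribution P V]_x x%:E = \int[P]_w (V w)%:E)%E.
  by move=> iV; rewrite (@integral_distribution _ _ _ _ _ P V EFin).
under eq_integral do under eq_integral do rewrite EFinM.
under eq_integral do rewrite (integralZl measurableT (iEFin Zv iZ)) (dE Zv iZ).
have fZ : (\int[P]_w (Z w)%:E)%E \is a fin_num by exact: integrable_fin_num.
rewrite -(fineK fZ) (integralZr measurableT (iEFin Yv iY)) (dE Yv iY).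
by rewrite fineK.
Qed.
End independence.

Section rectangles.
Context d (T : measurableType d) (R : realType) (P : probability T R).
Context (J : Type) (k : nat) (X : J -> 'I_k -> T -> R).
Hypothesis mX : forall i j, measurable_fun setT (X i j).

Definition rect n (f : 'I_n -> J) (B : 'I_n -> 'I_k -> set R) : set T :=
  \bigcap_(i in [set: 'I_n]) \bigcap_(j in [set: 'I_k]) (X (f i) j @^-1` B i j).

(** A pi-system generating the sigma-algebra of finitely many vectors. All coordinates of a vector
    are constrained together, because independence is assumed between vectors and not between their
    coordinates. *)
Definition rects n (f : 'I_n -> J) : set (set T) :=
  [set S | exists2 B, (forall i j, measurable (B i j)) & S = rect f B].

Lemma setI_closed_rects n (f : 'I_n -> J) : setI_closed (rects f).
Proof.
move=> _ _ [B mB ->] [B' mB' ->].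
exists (fun i j => B i j `&` B' i j); first by move=> i j; exact: measurableI.
apply/seteqP; split => [w [h1 h2] i _ j _|w h]; first by split; [exact: h1|exact: h2].
by split => i _ j _; have [] := h i I j I.
Qed.

Lemma rects_measurable n (f : 'I_n -> J) : rects f `<=` measurable.
Proof.
move=> _ [B mB ->].
apply: fin_bigcap_measurable => // i _; apply: fin_bigcap_measurable => // j _.
by rewrite -[X in measurable X]setTI; exact: mX.
Qed.

Lemma rects_gen_measurable n (f : 'I_n -> J) i j :
  measurable_fun (setT : set (g_sigma_algebraType (rects f))) (X (f i) j).
Proof.
move=> _ B mB; rewrite setTI; apply: sub_sigma_algebra.
exists (fun i' j' => if (i' == i) && (j' == j) then B else setT).
  by move=> i' j'; case: ifP.
apply/seteqP; split => [w Bw i' _ j' _|w h] /=; last first.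
  by have := h i I j I; rewrite /= !eqxx.
by case: ifP => // /andP[/eqP -> /eqP ->].
Qed.

(** The two index families are concatenated into one injective family of length [a + b]; mutual
    independence is used three times, for the whole and for each part. *)
Lemma indep_rects a b (f1 : 'I_a -> J) (f2 : 'I_b -> J) :
  mutually_indep_vecs P X -> injective f1 -> injective f2 ->
  (forall i j, f1 i <> f2 j) ->
  indep_systems P (rects f1) (rects f2).
Proof.
move=> ind i1 i2 d12 _ _ [B1 mB1 ->] [B2 mB2 ->].
pose f (i : 'I_(a + b)) := match fintype.split i with inl i => f1 i | inr j => f2 j end.
pose B (i : 'I_(a + b)) := match fintype.split i with inl i => B1 i | inr j => B2 j end.
have fl i : f (lshift b i) = f1 i.
  by rewrite /f -[lshift b i]/(unsplit (inl i)) unsplitK.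
have fr i : f (rshift a i) = f2 i.
  by rewrite /f -[rshift a i]/(unsplit (inr i)) unsplitK.
have Bl i : B (lshift b i) = B1 i.
  by rewrite /B -[lshift b i]/(unsplit (inl i)) unsplitK.
have Br i : B (rshift a i) = B2 i.
  by rewrite /B -[rshift a i]/(unsplit (inr i)) unsplitK.
have finj : injective f.
  move=> x y; rewrite -(fintype.splitK x) -(fintype.splitK y).
  case: (fintype.split x) => x'; case: (fintype.split y) => y' /=; rewrite ?fl ?fr.
  - by move/i1 ->.
  - by move/d12.
  - by move/esym/d12.
  - by move/i2 ->.
have mB i j : measurable (B i j) by rewrite /B; case: fintype.split.
have := ind _ _ finj _ mB; rewrite big_split_ord /=.
under eq_bigr do rewrite fl Bl.
under [X in (_ * X)%E]eq_bigr do rewrite fr Br.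
rewrite -(ind _ _ i1 _ mB1) -(ind _ _ i2 _ mB2) => <-.
congr (P _); apply/seteqP; split => [w [h1 h2] i _ j _|w h].
  rewrite -(fintype.splitK i); case: (fintype.split i) => i' /=; rewrite ?fl ?Bl ?fr ?Br.
    exact: h1.
  exact: h2.
split => i _ j _.
  by have := h (lshift b i) I j I; rewrite /= fl Bl.
by have := h (rshift a i) I j I; rewrite /= fr Br.
Qed.

Lemma indep_rv_of_disjoint a b (f1 : 'I_a -> J) (f2 : 'I_b -> J) (Y Z : T -> R) :
  mutually_indep_vecs P X -> injective f1 -> injective f2 ->
  (forall i j, f1 i <> f2 j) ->
  measurable_fun (setT : set (g_sigma_algebraType (rects f1))) Y ->
  measurable_fun (setT : set (g_sigma_algebraType (rects f2))) Z ->
  indep_rv P Y Z.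
Proof.
move=> ind i1 i2 d12 mY mZ A B mA mB.
apply: (@indep_systems_sigma2 _ _ _ P (rects f1) (rects f2)).
- exact: setI_closed_rects.
- exact: setI_closed_rects.
- exact: rects_measurable.
- exact: rects_measurable.
- exact: indep_rects.
- by have := mY measurableT _ mA; rewrite setTI.
- by have := mZ measurableT _ mB; rewrite setTI.
Qed.

End rectangles.

(** * Moving averages with geometric coefficients *)

Lemma geometric_sum_le (R : realType) (rho : R) N : 0 <= rho < 1 ->
  (1 - rho) * \sum_(i < N) rho ^+ i <= 1.
Proof.
move=> /andP[r0 r1]; rewrite -opprB mulNr -subrX1 opprB.
by rewrite gerBl exprn_ge0.
Qed.

(** A weighted sum of squares around [c] is nonnegative. The optimal centre would be the weighted
    mean; [c] replaces the total weight by its bound 1 / (1 - rho), which gives a constant free of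
    [N]. *)
Lemma geometric_cauchy_schwarz (R : realType) (rho : R) N (b : nat -> R) :
  0 <= rho < 1 ->
  (1 - rho) * (\sum_(i < N) rho ^+ i * b i) ^+ 2 <= \sum_(i < N) rho ^+ i * b i ^+ 2.
Proof.
move=> rho01; have := geometric_sum_le N rho01; move: rho01 => /andP[r0 r1].
set W := \sum_(i < N) rho ^+ i; set A := \sum_(i < N) _; set Q := \sum_(i < N) _ => hW.
pose c := (1 - rho) * A.
have : 0 <= \sum_(i < N) rho ^+ i * (c - b i) ^+ 2.
  by apply: sumr_ge0 => i _; rewrite mulr_ge0 ?sqr_ge0 ?exprn_ge0.
have -> : \sum_(i < N) rho ^+ i * (c - b i) ^+ 2 = c ^+ 2 * W - 2 * c * A + Q.
  rewrite /W /A /Q !mulr_sumr -sumrB -big_split /=; apply: eq_bigr => i _; ring.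
have : c ^+ 2 * W <= (1 - rho) * A ^+ 2.
  rewrite [leLHS](_ : _ = (1 - rho) * A ^+ 2 * ((1 - rho) * W)); last by rewrite /c; ring.
  apply: ler_piMr => //; apply: mulr_ge0; last exact: sqr_ge0.
  by rewrite subr_ge0 ltW.
rewrite [2 * c * A](_ : _ = 2 * ((1 - rho) * A ^+ 2)); last by rewrite /c; ring.
move: ((1 - rho) * _) => x; lra.
Qed.

(** If the series on the right is infinite there is nothing to prove. If it is finite, the weighted
    Cauchy-Schwarz inequality bounds the partial sums of the absolute values, so the limit exists
    and its tail inherits the bound. *)
Lemma geometric_tail_bound (R : realType) (K rho : R) (a b : nat -> R) n :
  0 < K -> 0 < rho < 1 -> (forall j, 0 <= b j) ->
  (forall j, `|a j| <= K * rho ^+ j * b j) ->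
  (((limn (fun N => \sum_(j < N) a j) - \sum_(j < n) a j) ^+ 2)%:E <=
   (K ^+ 2 * rho ^+ n ^+ 2 / (1 - rho))%:E *
     \sum_(0 <= j <oo) (rho ^+ j * b (n + j)%N ^+ 2)%:E)%E.
Proof.
move=> K0 /andP[r0 r1] b0 ab.
have rho01 : 0 <= rho < 1 by rewrite ltW.
have r1' : 0 < 1 - rho by rewrite subr_gt0.
have c0 : 0 < K ^+ 2 * rho ^+ n ^+ 2 / (1 - rho) by rewrite !mulr_gt0 ?exprn_gt0 ?invr_gt0.
have q0 j : (0 <= (rho ^+ j * b (n + j)%N ^+ 2)%:E)%E.
  by rewrite lee_fin mulr_ge0 ?sqr_ge0 ?exprn_ge0// ltW.
set Q := (\sum_(0 <= j <oo) _)%E.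
have Q0 : (0 <= Q)%E by apply: nneseries_ge0 => j _ _; exact: q0.
have QN N : ((\sum_(i < N) rho ^+ i * b (n + i)%N ^+ 2)%:E <= Q)%E.
  rewrite -sumEFin -(big_mkord xpredT (fun i => (rho ^+ i * b (n + i)%N ^+ 2)%:E)).
  by apply: nneseries_lim_ge => j _ _; exact: q0.
move: Q0 QN; case: Q => [Q||] // Q0 QN; last by rewrite gt0_muley ?lte_fin// leey.
rewrite -EFinM lee_fin; set V := _ * Q.
have V0 : 0 <= V by rewrite mulr_ge0 // ltW.
have bnd N : \sum_(i < N) `|a (n + i)%N| <= Num.sqrt V.
  apply: (@le_trans _ _ (K * rho ^+ n * \sum_(i < N) rho ^+ i * b (n + i)%N)).
    rewrite mulr_sumr; apply: ler_sum => i _; apply: le_trans (ab _) _.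
    by rewrite exprD !mulrA.
  rewrite -(@ler_pXn2r _ 2) ?nnegrE ?sqrtr_ge0//; last first.
    rewrite !mulr_ge0 ?exprn_ge0 ?(ltW r0) ?(ltW K0)// sumr_ge0// => i _.
    by rewrite mulr_ge0 ?exprn_ge0 ?(ltW r0).
  rewrite sqr_sqrtr// /V !exprMn -!mulrA !ler_pM2l ?exprn_gt0//.
  rewrite ler_pdivlMl//; have := QN N; rewrite lee_fin => h; apply: le_trans h.
  exact: (geometric_cauchy_schwarz N (fun i => b (n + i)%N) rho01).
have split_sum (f : nat -> R) N : 
    \sum_(j < n + N) f j = \sum_(j < n) f j + \sum_(i < N) f (n + i)%N.
  by rewrite big_split_ord.
have cvS : cvgn (fun N => \sum_(j < N) a j).
  have -> : (fun N => \sum_(j < N) a j) = series a.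
    by apply/funext => N; rewrite /series /= big_mkord.
  apply: normed_cvg.
  rewrite [X in cvgn X](_ : _ = fun N => \sum_(j < N) `|a j|); last first.
    by apply/funext => N; rewrite /normed_series_of /series /= big_mkord.
  apply: nondecreasing_is_cvgn.
    by apply/nondecreasing_seqP => N; rewrite big_ord_recr /= lerDl.
  exists (\sum_(j < n) `|a j| + Num.sqrt V) => _ [N _ <-].
  apply: (@le_trans _ _ (\sum_(j < N + n) `|a j|)).
    by rewrite big_split_ord /= lerDl sumr_ge0.
  by rewrite addnC (split_sum (fun j => `|a j|)) lerD2l.
set S := limn _.
have cvu : (fun N => `|\sum_(j < N) a j - \sum_(j < n) a j|) @ \oo --> `|S - \sum_(j < n) a j|.
  by apply: cvg_norm; apply: cvgB => //; exact: cvg_cst.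
have : `|S - \sum_(j < n) a j| <= Num.sqrt V.
  rewrite -(cvg_lim _ cvu)//; apply: limr_le; first by apply/cvg_ex; eexists; exact: cvu.
  exists n => // N /= nN; rewrite -(subnKC nN) split_sum addrAC subrr add0r.
  by apply: le_trans (ler_norm_sum _ _ _) _.
move=> h; rewrite -[V]sqr_sqrtr// -[X in X <= _]real_normK ?num_real//.
by rewrite ler_pXn2r ?nnegrE ?sqrtr_ge0.
Qed.

Lemma integral_geometric_le d (T : measurableType d) (R : realType)
    (mu : {measure set T -> \bar R}) (rho B : R) (f : nat -> T -> R) :
  0 <= rho < 1 -> 0 <= B -> (forall j, measurable_fun setT (f j)) -> (forall j w, 0 <= f j w) ->
  (forall j, \int[mu]_w (f j w)%:E <= B%:E)%E ->
  (\int[mu]_w (\sum_(0 <= j <oo) (rho ^+ j * f j w)%:E) <= (B / (1 - rho))%:E)%E.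
Proof.
move=> rho01 B0 mf f0 fB; have /andP[r0 r1] := rho01.
have r1' : 0 < 1 - rho by rewrite subr_gt0.
rewrite integral_nneseries//; last 2 first.
  by move=> n; apply/measurable_EFinP; apply: measurable_funM.
  by move=> n w _; rewrite lee_fin mulr_ge0 ?exprn_ge0.
apply: lime_le.
  apply: is_cvg_nneseries => n _ _; apply: integral_ge0 => w _.
  by rewrite lee_fin mulr_ge0 ?exprn_ge0.
apply: nearW => N; rewrite big_mkord.
apply: (@le_trans _ _ (\sum_(i < N) (rho ^+ i * B)%:E)%E).
  apply: lee_sum => i _; under eq_integral do rewrite EFinM.
  rewrite ge0_integralZl//.
  - by rewrite EFinM lee_wpmul2l ?lee_fin ?exprn_ge0.
  - by apply/measurable_EFinP.
  - by move=> w _; rewrite lee_fin.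
  - by rewrite lee_fin exprn_ge0.
rewrite sumEFin lee_fin -mulr_suml ler_pdivlMr//.
have := geometric_sum_le N rho01; nra.
Qed.

(** Expand the nonnegative sum of [(f i - f j) ^+ 2] over all pairs. *)
Lemma sqrsum_le_card (R : realType) (I : finType) (f : I -> R) :
  (\sum_i f i) ^+ 2 <= #|I|%:R * \sum_i f i ^+ 2.
Proof.
have : 0 <= \sum_i \sum_j (f i - f j) ^+ 2.
  by apply: sumr_ge0 => i _; apply: sumr_ge0 => j _; rewrite sqr_ge0.
have -> : \sum_i \sum_j (f i - f j) ^+ 2 =
    2 * (#|I|%:R * \sum_i f i ^+ 2) - 2 * (\sum_i f i) ^+ 2.
  transitivity (\sum_i (#|I|%:R * f i ^+ 2 + \sum_j f j ^+ 2 - 2 * (f i * \sum_j f j))).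
    apply: eq_bigr => i _.
    rewrite (_ : #|I|%:R * f i ^+ 2 = \sum_(j : I) f i ^+ 2); last first.
      by rewrite sumr_const mulr_natl.
    rewrite !mulr_sumr -big_split -sumrB /=; apply: eq_bigr => j _; ring.
  rewrite sumrB big_split /= -!mulr_sumr -mulr_suml sumr_const.
  rewrite -[(\sum_i f i ^+ 2) *+ _]mulr_natl; ring.
by move: (_ * \sum_i _) => x; lra.
Qed.

Lemma integral_le_sum d (T : measurableType d) (R : realType)
    (mu : {measure set T -> \bar R}) (I : finType) (f : I -> T -> R) (g : T -> R) (c B : R) :
  0 <= c -> measurable_fun setT g -> (forall i, measurable_fun setT (f i)) ->
  (forall w, 0 <= g w) -> (forall i w, 0 <= f i w) ->
  (forall w, g w <= c * \sum_i f i w) ->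
  (forall i, \int[mu]_w (f i w)%:E <= B%:E)%E ->
  (\int[mu]_w (g w)%:E <= (c * (#|I|%:R * B))%:E)%E.
Proof.
move=> c0 mg mf g0 f0 gf fB.
have s0 w : 0 <= \sum_i f i w by apply: sumr_ge0 => i _.
apply: (@le_trans _ _ (\int[mu]_w (c * \sum_i f i w)%:E)%E).
  apply: ge0_le_integral => //.
  - by move=> w _; rewrite lee_fin.
  - exact/measurable_EFinP.
  - apply/measurable_EFinP; apply: measurable_funM => //; exact: measurable_sum.
  - by move=> w _; rewrite lee_fin.
under eq_integral do rewrite EFinM.
rewrite ge0_integralZl_EFin//; last 2 first.
- by move=> w _; rewrite lee_fin.
- apply/measurable_EFinP; exact: measurable_sum.
rewrite EFinM lee_wpmul2l ?lee_fin//.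
under eq_integral do rewrite -sumEFin.
rewrite ge0_integral_sum//; last 2 first.
- by move=> i; apply/measurable_EFinP.
- by move=> i w _; rewrite lee_fin.
apply: (@le_trans _ _ (\sum_(i : I) B%:E)%E); first exact: lee_sum.
by rewrite sumEFin lee_fin sumr_const mulr_natl.
Qed.

Lemma Lfun2_sqr_le d (T : measurableType d) (R : realType)
    (mu : {measure set T -> \bar R}) (f : T -> R) (B : R) :
  measurable_fun setT f -> (\int[mu]_w (f w ^+ 2)%:E <= B%:E)%E -> f \in Lfun mu 2%:E.
Proof.
move=> mf fB; rewrite inE; apply/andP; split; rewrite inE //=.
rewrite /finite_norm unlock /Lnorm poweR_lty//.
apply: le_lt_trans (ltry B); apply: le_trans fB.
rewrite le_eqVlt; apply/orP; left; apply/eqP; apply: eq_integral => w _.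
by rewrite /= powR_mulrn// real_normK// num_real.
Qed.

Lemma sqr_le_powR (R : realType) (delta x : R) : 0 < delta ->
  x ^+ 2 <= 1 + `|x| `^ (2 + delta).
Proof.
move=> d0; rewrite -real_normK ?num_real//.
have [x1|x1] := leP `|x| 1.
  by apply: (@le_trans _ _ 1); [rewrite expr_le1|rewrite lerDl powR_ge0].
rewrite -powR_mulrn//; apply: le_trans (_ : `|x| `^ (2 + delta) <= _); last by rewrite lerDr.
by apply: ler_powR; rewrite ?(ltW x1)// lerDl ltW.
Qed.

Section truncation.
Context (T : Type) (R : realType) (d q m L : nat).
Context (eps : 'I_L.+1 -> int -> 'I_d -> T -> R) (C : nat -> 'I_L.+1 -> 'M[R]_d).
Context (phi : 'I_d -> 'I_L -> R) (r : 'I_L -> ('I_q -> R))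
        (dist : ('I_q -> R) -> ('I_q -> R) -> R) (s : nat -> ('I_q -> R)).

Definition MAtrunc n (l : 'I_L.+1) (t : int) (nu : 'I_d) (w : T) : R :=
  \sum_(j < n) \sum_(k < d) C j l nu k * eps l (t - j%:Z) k w.

Definition Utrunc n (t : int) (x : 'I_q -> R) (nu : 'I_d) (w : T) : R :=
  \sum_(l < L) phi nu l * dist x (r l) * MAtrunc n (lift ord0 l) t nu w
  + MAtrunc n ord0 t nu w.

Definition Umtrunc n (t : nat) (w : T) : 'M[R]_(d, m.+1) :=
  \matrix_(i < d, k < m.+1) Utrunc n (t%:Z - k%:Z) (s t) i w.

Lemma Umtrunc0 t w : Umtrunc 0 t w = 0.
Proof.
apply/matrixP => i k; rewrite !mxE /Utrunc /MAtrunc big_ord0 addr0.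
by rewrite big1// => l _; rewrite big_ord0 mulr0.
Qed.

End truncation.

Lemma measurable_fun_Umtrunc d' (T : measurableType d') (R : realType) (d q m L : nat)
    (eps : 'I_L.+1 -> int -> 'I_d -> T -> R) C phi (r : 'I_L -> ('I_q -> R))
    dist s n t i (k : 'I_m.+1) :
  (forall l (k : 'I_m.+1) (j : 'I_n) i, measurable_fun setT (eps l (t%:Z - k%:Z - j%:Z) i)) ->
  measurable_fun setT (fun w => @Umtrunc T R d q m L eps C phi r dist s n t w i k).
Proof.
move=> me.
have mMA l : measurable_fun setT (MAtrunc eps C n l (t%:Z - k%:Z) i).
  by apply: measurable_sum => j; apply: measurable_sum => k'; apply: measurable_funM.
under eq_fun do rewrite mxE.
apply: measurable_funD => //; apply: measurable_sum => l.
by apply: measurable_funM.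
Qed.

(** * Covariances *)

Section covariance_bounds.
Context d (T : measurableType d) (R : realType) (P : probability T R).

Let Pfin : P setT \is a fin_num.
Proof. exact: fin_num_measure. Qed.

Lemma variance_le_sqr (X : T -> R) (B : R) : X \in Lfun P 2%:E ->
  (\int[P]_w (X w ^+ 2)%:E <= B%:E)%E -> ('V_P[X] <= B%:E)%E.
Proof.
move=> X2 XB; rewrite varianceE//; apply: le_trans XB.
have fE : ('E_P[X])%E \is a fin_num by apply: expectation_fin_num; exact: Lfun_subset12.
rewrite [X in (X - _)%E](_ : _ = \int[P]_w (X w ^+ 2)%:E)%E; last first.
  by rewrite unlock; apply: eq_integral.
rewrite leeBlDr ?fin_numX// leeDl//.
by rewrite -(fineK fE) -EFin_expe lee_fin sqr_ge0.
Qed.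

Lemma covariance_fineK (X Y : T -> R) : X \in Lfun P 2%:E -> Y \in Lfun P 2%:E ->
  covariance P X Y = (fine (covariance P X Y))%:E.
Proof.
move=> X2 Y2; rewrite fineK//; apply: covariance_fin_num.
- exact: Lfun_subset12.
- exact: Lfun_subset12.
- exact: Lfun2_mul_Lfun1.
Qed.

Lemma covariance_abs_le (X Y : T -> R) (x y : R) : 0 <= x -> 0 <= y ->
  X \in Lfun P 2%:E -> Y \in Lfun P 2%:E ->
  ('V_P[X] <= (x ^+ 2)%:E)%E -> ('V_P[Y] <= (y ^+ 2)%:E)%E ->
  `|fine (covariance P X Y)| <= x * y.
Proof.
move=> x0 y0 X2 Y2 Xx Yy.
have H (Z W : T -> R) z w : 0 <= z -> 0 <= w -> Z \in Lfun P 2%:E -> W \in Lfun P 2%:E ->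
    ('V_P[Z] <= (z ^+ 2)%:E)%E -> ('V_P[W] <= (w ^+ 2)%:E)%E ->
    fine (covariance P Z W) <= z * w.
  move=> z0 w0 Z2 W2 Zz Ww; rewrite -lee_fin -covariance_fineK//.
  apply: le_trans (covariance_le Z2 W2) _; rewrite EFinM.
  have S (v : \bar R) (u : R) : 0 <= u -> (v <= (u ^+ 2)%:E)%E -> (sqrte v <= u%:E)%E.
    move=> u0 vu; rewrite (_ : u%:E = sqrte (u ^+ 2)%:E).
      by rewrite lee_sqrt// lee_fin sqr_ge0.
    by rewrite /= sqrtr_sqr ger0_norm.
  by apply: lee_pmul; rewrite ?sqrte_ge0//; exact: S.
rewrite ler_norml; apply/andP; split; last exact: H.
rewrite lerNl.
(* Cauchy-Schwarz gives only an upper bound; the lower one is the same bound for [- X]. *)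
have -> : - fine (covariance P X Y) = fine (covariance P (\- X) Y).
  rewrite covarianceNl; first by rewrite fineN.
  - exact: Lfun_subset12.
  - exact: Lfun_subset12.
  - exact: Lfun2_mul_Lfun1.
by apply: H => //; rewrite ?rpredN// varianceN.
Qed.

(* Expanding [cov X Y] around [X'] and [Y'] leaves only terms with a small
   factor, since [cov X' Y' = 0]. *)
Lemma covariance_approx_indep (X Y X' Y' : T -> R) (b e : R) :
  0 <= b -> 0 <= e <= 1 ->
  X \in Lfun P 2%:E -> Y \in Lfun P 2%:E -> X' \in Lfun P 2%:E -> Y' \in Lfun P 2%:E ->
  ('V_P[X] <= (b ^+ 2)%:E)%E -> ('V_P[Y] <= (b ^+ 2)%:E)%E ->
  ('V_P[(X \- X')%R] <= ((b * e) ^+ 2)%:E)%E -> ('V_P[(Y \- Y')%R] <= ((b * e) ^+ 2)%:E)%E ->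
  indep_rv P X' Y' ->
  `|fine (covariance P X Y)| <= 3 * b ^+ 2 * e.
Proof.
move=> b0 /andP[e0 e1] X2 Y2 X'2 Y'2 VX VY VXX VYY ind.
have be0 : 0 <= b * e by rewrite mulr_ge0.
have XX2 : (X \- X')%R \in Lfun P 2%:E by rewrite rpredB// lee1n.
have YY2 : (Y \- Y')%R \in Lfun P 2%:E by rewrite rpredB// lee1n.
have z : covariance P X' Y' = 0%E.
  have L1 (Z : T -> R) : Z \in Lfun P 2%:E -> Z \in Lfun P 1 by exact: Lfun_subset12.
  have XY1 : (X' \* Y')%R \in Lfun P 1 by exact: Lfun2_mul_Lfun1.
  rewrite covarianceE; [|exact: L1|exact: L1|exact: XY1].
  rewrite [X in (X - _)%E](indep_rv_expectationM ind _ _ XY1); [|exact: L1|exact: L1].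
  by rewrite subee// fin_numM ?expectation_fin_num ?L1.
have cB (U V W : T -> R) : U \in Lfun P 2%:E -> V \in Lfun P 2%:E -> W \in Lfun P 2%:E ->
    fine (covariance P (U \- V) W) = fine (covariance P U W) - fine (covariance P V W).
  move=> U2 V2 W2; rewrite covarianceBl//.
  by rewrite (covariance_fineK U2 W2) (covariance_fineK V2 W2).
have cBr (U V W : T -> R) : U \in Lfun P 2%:E -> V \in Lfun P 2%:E -> W \in Lfun P 2%:E ->
    fine (covariance P W (U \- V)) = fine (covariance P W U) - fine (covariance P W V).
  by move=> U2 V2 W2; rewrite covarianceC cB// covarianceC [covariance P V W]covarianceC.
have c1 := covariance_abs_le be0 b0 XX2 Y2 VXX VY.
have c2 := covariance_abs_le b0 be0 X2 YY2 VX VYY.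
have c3 := covariance_abs_le be0 be0 XX2 YY2 VXX VYY.
move: c1 c2 c3; rewrite !cB// !cBr//.
rewrite z /=.
rewrite -[3 * _ * _]mulrA; move: (fine _) (fine _) (fine _) => p1 p2 p3.
(* With [cov X' Y' = 0], the covariance of [X] and [Y] equals [cov (X - X') Y + cov X (Y - Y') - cov
   (X - X') (Y - Y')]. The last term is of order [e ^+ 2], absorbed using [e <= 1]; three equal
   bounds give the constant 3. *)
have h1 : b * e * (b * e) <= b ^+ 2 * e.
  by rewrite (_ : b * e * (b * e) = b ^+ 2 * e * e); [rewrite ler_piMr// mulr_ge0 ?sqr_ge0|ring].
have h2 : b * (b * e) = b ^+ 2 * e by ring.
have h3 : b * e * b = b ^+ 2 * e by ring.
rewrite !ler_norml; move: h1 h2 h3.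
move: (b * (b * e)) (b * e * b) (b * e * (b * e)) (b ^+ 2 * e) => x1 x2 x3 x4 h1 h2 h3.
by move=> /andP[? ?] /andP[? ?] /andP[? ?]; apply/andP; split; lra.
Qed.

End covariance_bounds.

Section moments.
Context (R : realType) (dsp : measure_display) (Omega : measurableType dsp)
  (P : probability Omega R) (d q m L : nat)
  (eps : 'I_L.+1 -> int -> 'I_d -> Omega -> R) (C : nat -> 'I_L.+1 -> 'M[R]_d)
  (phi : 'I_d -> 'I_L -> R) (r : 'I_L -> 'I_q -> R)
  (dist : ('I_q -> R) -> ('I_q -> R) -> R)
  (h : 'M[R]_(d, m.+1) -> R) (s : nat -> 'I_q -> R).
Context (M K rho LH : R).
Hypotheses (dist01 : forall t l, 0 <= dist (s t) (r l) <= 1)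
  (meps : forall l t k, measurable_fun setT (eps l t k))
  (epsM : forall l t k, (\int[P]_w (eps l t k w ^+ 2)%:E <= M%:E)%E)
  (M0 : 0 <= M) (K0 : 0 < K) (rho01 : 0 < rho < 1)
  (CK : forall j l i k, `|C j l i k| <= K * rho ^+ j)
  (hlip : forall A B, `|h A - h B| <= LH * frob (A - B)).

Local Notation MA := (MAproc eps C).
Local Notation MAn := (MAtrunc eps C).
Local Notation U := (Umat m eps C phi r dist s).
Local Notation Un := (Umtrunc m eps C phi r dist s).

Lemma measurable_fun_MAtrunc n l t i : measurable_fun setT (MAn n l t i).
Proof.
by apply: measurable_sum => j; apply: measurable_sum => k'; apply: measurable_funM.
Qed.

Lemma measurable_fun_MAproc l t i : measurable_fun setT (MA l t i).
Proof.
by apply: measurable_fun_limn => n; exact: measurable_fun_MAtrunc.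
Qed.

(** The pointwise tail bound is integrated. One factor 1 / (1 - rho) comes from the weighted
    Cauchy-Schwarz inequality, the other from summing the weights; one [d] comes from squaring a sum
    of [d] innovations and one from adding up their second moments. *)
Lemma MAtrunc_L2 n l t i :
  (\int[P]_w ((MA l t i w - MAn n l t i w) ^+ 2)%:E <=
   (K ^+ 2 * (d%:R * (d%:R * M)) / (1 - rho) ^+ 2 * rho ^+ n ^+ 2)%:E)%E.
Proof.
have /andP[r0 r1] := rho01; have r1' : 0 < 1 - rho by rewrite subr_gt0.
pose b j w := \sum_k `|eps l (t - j%:Z) k w|.
have b0 j w : 0 <= b j w by apply: sumr_ge0.
have mb j : measurable_fun setT (b j).
  by apply: measurable_sum => k; apply: measurableT_comp.
have mb2 j : measurable_fun setT (fun w => b j w ^+ 2) by exact: measurable_funX.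
have bM j : (\int[P]_w (b j w ^+ 2)%:E <= (d%:R * (d%:R * M))%:E)%E.
  have := @integral_le_sum _ _ _ P _ (fun (k : 'I_d) w => eps l (t - j%:Z) k w ^+ 2)
    (fun w => b j w ^+ 2) d%:R M.
  rewrite card_ord; apply => //.
  - by move=> k; exact: measurable_funX.
  - by move=> w; rewrite sqr_ge0.
  - by move=> k w; rewrite sqr_ge0.
  - move=> w; apply: le_trans (sqrsum_le_card _) _; rewrite card_ord ler_wpM2l//.
    by apply: ler_sum => k _; rewrite real_normK// num_real.
pose a j w := \sum_(k < d) C j l i k * eps l (t - j%:Z) k w.
have ab j w : `|a j w| <= K * rho ^+ j * b j w.
  apply: le_trans (ler_norm_sum _ _ _) _; rewrite mulr_sumr; apply: ler_sum => k _.
  by rewrite normrM ler_wpM2r.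
pose c := K ^+ 2 * rho ^+ n ^+ 2 / (1 - rho).
have c0 : 0 <= c by exact: divr_ge0 (mulr_ge0 (sqr_ge0 _) (sqr_ge0 _)) (ltW r1').
pose Q w := (\sum_(0 <= j <oo) (rho ^+ j * b (n + j)%N w ^+ 2)%:E)%E.
have q0 j w : (0 <= (rho ^+ j * b (n + j)%N w ^+ 2)%:E)%E.
  by rewrite lee_fin mulr_ge0 ?sqr_ge0 ?exprn_ge0// ltW.
have mQ : measurable_fun setT Q.
  apply: ge0_emeasurable_sum => // j _.
  by apply/measurable_EFinP; apply: measurable_funM.
have Q0 w : (0 <= Q w)%E by apply: nneseries_ge0 => j _ _; exact: q0.
apply: (@le_trans _ _ (\int[P]_w (c%:E * Q w))%E).
  apply: ge0_le_integral => //.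
  - by move=> w _; rewrite lee_fin sqr_ge0.
  - apply/measurable_EFinP; apply: measurable_funX; apply: measurable_funB.
      exact: measurable_fun_MAproc.
    exact: measurable_fun_MAtrunc.
  - by apply: measurable_funeM.
  - by move=> w _; exact: (@geometric_tail_bound _ K rho (a^~ w) (b^~ w) n).
rewrite ge0_integralZl_EFin//.
apply: (@le_trans _ _ (c%:E * (d%:R * (d%:R * M) / (1 - rho))%:E)%E).
  apply: lee_wpmul2l; first by rewrite lee_fin.
  apply: integral_geometric_le => //.
  - by rewrite (ltW r0) r1.
  - by rewrite !mulr_ge0.
  - by move=> j w; rewrite sqr_ge0.
rewrite -EFinM lee_fin /c le_eqVlt; apply/orP; left; apply/eqP.
by field; rewrite gt_eqF.
Qed.

Lemma Umtrunc_L2 : exists2 B, 0 <= B & forall n t i k,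
  (\int[P]_w ((U t w i k - Un n t w i k) ^+ 2)%:E <= (B * rho ^+ n ^+ 2)%:E)%E.
Proof.
have /andP[r0 r1] := rho01; have r1' : 0 < 1 - rho by rewrite subr_gt0.
pose B0 := K ^+ 2 * (d%:R * (d%:R * M)) / (1 - rho) ^+ 2.
pose Phi := 1 + \sum_i \sum_l `|phi i l|.
have B00 : 0 <= B0.
  by apply: divr_ge0 (sqr_ge0 _); apply: mulr_ge0 (sqr_ge0 _) _; rewrite !mulr_ge0.
have LPhi0 : 0 <= L.+1%:R * Phi ^+ 2 by apply: mulr_ge0 (sqr_ge0 _).
have Phi1 : 1 <= Phi by rewrite lerDl; apply: sumr_ge0 => i _; apply: sumr_ge0.
have phiP i l : `|phi i l| <= Phi.
  apply: (@le_trans _ _ (\sum_l `|phi i l|)); first by rewrite (bigD1 l)//= lerDl sumr_ge0.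
  by rewrite /Phi (bigD1 i)//= addrCA lerDl addr_ge0// sumr_ge0// => j _; rewrite sumr_ge0.
exists (L.+1%:R * Phi ^+ 2 * (L.+1%:R * B0)).
  by apply: mulr_ge0 LPhi0 _; rewrite mulr_ge0.
move=> n t i k.
pose D (l : 'I_L.+1) w := MA l (t%:Z - k%:Z) i w - MAn n l (t%:Z - k%:Z) i w.
(* The noise process, at index 0, is treated as one more factor with loading 1, which is why [Phi]
   is chosen at least 1. *)
pose e (l : 'I_L.+1) := if unlift ord0 l is Some l' then phi i l' * dist (s t) (r l') else 1.
have eP l : e l ^+ 2 <= Phi ^+ 2.
  rewrite -[X in X <= _]real_normK ?num_real// ler_pXn2r ?nnegrE//; last by lra.
  rewrite /e; case: unliftP => [l' _|_]; last by rewrite normr1.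
  have /andP[d0 d1] := dist01 t l'.
  by rewrite normrM (ger0_norm d0); apply: le_trans (ler_piMr _ _) _.
have mD l : measurable_fun setT (D l).
  by apply: measurable_funB; [exact: measurable_fun_MAproc|exact: measurable_fun_MAtrunc].
have UE w : U t w i k - Un n t w i k = \sum_l e l * D l w.
  rewrite !mxE /Ufield /Utrunc big_ord_recl /e unlift_none mul1r /D.
  rewrite [X in _ = _ + X](_ : _ = \sum_(l < L)
      (phi i l * dist (s t) (r l) * MA (lift ord0 l) (t%:Z - k%:Z) i w -
       phi i l * dist (s t) (r l) * MAn n (lift ord0 l) (t%:Z - k%:Z) i w)); last first.
    by apply: eq_bigr => l _; rewrite liftK mulrBr.
  rewrite sumrB; ring.
rewrite (_ : _ * rho ^+ n ^+ 2 =
    L.+1%:R * Phi ^+ 2 * (#|'I_L.+1|%:R * (B0 * rho ^+ n ^+ 2))); last first.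
  by rewrite card_ord; ring.
apply: (integral_le_sum (f := fun l w => D l w ^+ 2)) => //.
- apply: measurable_funX; under eq_fun do rewrite UE.
  by apply: measurable_sum => l; apply: measurable_funM.
- by move=> l; exact: measurable_funX.
- by move=> w; rewrite sqr_ge0.
- by move=> l w; rewrite sqr_ge0.
- move=> w; rewrite UE; apply: le_trans (sqrsum_le_card _) _.
  rewrite card_ord -mulrA ler_wpM2l// mulr_sumr; apply: ler_sum => l _.
  by rewrite exprMn ler_wpM2r ?sqr_ge0.
- by move=> l; exact: MAtrunc_L2.
Qed.

Lemma measurable_fun_hU t : measurable_fun setT (fun w => h (U t w)).
Proof.
apply: (measurable_fun_lipschitz_mx hlip) => i k.
under eq_fun do rewrite mxE.
apply: measurable_funD; last exact: measurable_fun_MAproc.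
by apply: measurable_sum => l; apply: measurable_funM => //; exact: measurable_fun_MAproc.
Qed.

Lemma measurable_fun_hUn n t : measurable_fun setT (fun w => h (Un n t w)).
Proof.
by apply: (measurable_fun_lipschitz_mx hlip) => i k; exact: measurable_fun_Umtrunc.
Qed.

Lemma hUn_L2 : exists2 B, 0 <= B & forall n t,
  (\int[P]_w ((h (U t w) - h (Un n t w)) ^+ 2)%:E <= (B * rho ^+ n ^+ 2)%:E)%E.
Proof.
have [B B0 hB] := Umtrunc_L2.
exists (LH ^+ 2 * (#|{: 'I_d * 'I_m.+1}|%:R * B)).
  by apply: mulr_ge0 (sqr_ge0 _) _; rewrite mulr_ge0.
move=> n t.
rewrite (_ : _ * rho ^+ n ^+ 2 =
    LH ^+ 2 * (#|{: 'I_d * 'I_m.+1}|%:R * (B * rho ^+ n ^+ 2))); last by ring.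
apply: (integral_le_sum
  (f := fun (ik : 'I_d * 'I_m.+1) w => (U t w ik.1 ik.2 - Un n t w ik.1 ik.2) ^+ 2)) => //.
- by rewrite sqr_ge0.
- apply: measurable_funX; apply: measurable_funB; first exact: measurable_fun_hU.
  exact: measurable_fun_hUn.
- move=> -[i k] /=; apply: measurable_funX; apply: measurable_funB;
    last exact: measurable_fun_Umtrunc.
  under eq_fun do rewrite mxE.
  apply: measurable_funD; last exact: measurable_fun_MAproc.
  by apply: measurable_sum => l; apply: measurable_funM => //; exact: measurable_fun_MAproc.
- by move=> w; rewrite sqr_ge0.
- by move=> ? w; rewrite sqr_ge0.
- move=> w; rewrite -(pair_bigA _ (fun i k => (U t w i k - Un n t w i k) ^+ 2)) /=.
  rewrite -real_normK ?num_real//.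
  have -> : \sum_(i < d) \sum_(j < m.+1) (U t w i j - Un n t w i j) ^+ 2 =
      frob (U t w - Un n t w) ^+ 2.
    rewrite frob_sqr; apply: eq_bigr => i _; apply: eq_bigr => j _.
    by congr (_ ^+ 2); rewrite [RHS]mxE; congr (_ + _); rewrite [RHS]mxE.
  rewrite -exprMn ler_pXn2r ?nnegrE//.
  exact: le_trans (normr_ge0 _) (hlip _ _).
Qed.

Hypothesis ind : mutually_indep_vecs P (fun lt : 'I_L.+1 * int => eps lt.1 lt.2).

(* Both truncated variables are functions of the innovations in a time window of
   length [n + m], and the two windows are disjoint. *)
Lemma indep_hUn n (t1 t2 : nat) : (t1 + (n + m) <= t2)%N ->
  indep_rv P (fun w => h (Un n t1 w)) (fun w => h (Un n t2 w)).
Proof.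
move=> t12.
(* A column shift is at most [m] and a moving average lag at most [n - 1], so every innovation
   involved has a total lag below [n + m]. *)
pose F : finType := ('I_L.+1 * 'I_(n + m))%type.
pose f (t : nat) (i : 'I_#|F|) : 'I_L.+1 * int :=
  ((enum_val i : F).1, t%:Z - (enum_val i : F).2%:Z).
have fi t : injective (f t).
  move=> i j [e1 e2]; apply: enum_val_inj.
  have : (enum_val i : F).2 = (enum_val j : F).2 by apply: val_inj => /=; lia.
  by case: (enum_val i) e1 => a b /= ->; case: (enum_val j) => a' b' /= ->.
have mh t : measurable_fun (setT : set (g_sigma_algebraType
    (rects (fun lt : 'I_L.+1 * int => eps lt.1 lt.2) (f t)))) (fun w => h (Un n t w)).
  apply: (measurable_fun_lipschitz_mx hlip) => i k.
  apply: measurable_fun_Umtrunc => l k' j i'.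
  have kj : (k' + j < n + m)%N by have := ltn_ord k'; have := ltn_ord j; lia.
  have := @rects_gen_measurable _ Omega R _ _ (fun lt : 'I_L.+1 * int => eps lt.1 lt.2)
    _ (f t) (enum_rank ((l, Ordinal kj) : F)) i'.
  rewrite /f enum_rankK /=.
  by have -> : t%:Z - (k' + j)%N%:Z = t%:Z - k'%:Z - j%:Z by lia.
apply: (indep_rv_of_disjoint _ ind (fi t1) (fi t2) _ (mh t1) (mh t2)).
  by move=> [l t] j; exact: meps.
move=> i j [_]; have := ltn_ord (enum_val j : F).2.
by move: (nat_of_ord _) (nat_of_ord _) => a b; lia.
Qed.

(** The exponent is the distance of [t1] and [t2], written with truncated subtraction. At distance
    at least [m] the truncation lag is the distance minus [m], and the division by [rho ^+ m] pays
    for the loss. *)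
Lemma hU_covariance_decay : exists2 B, 0 <= B & forall t1 t2 : nat,
  [/\ (fun w => h (U t1 w)) \in Lfun P 2%:E &
  `|fine (covariance P (fun w => h (U t1 w)) (fun w => h (U t2 w)))|
    <= B * rho ^+ ((t1 - t2) + (t2 - t1))].
Proof.
have /andP[r0 r1] := rho01.
have [B B0 hB] := hUn_L2.
have Pfin : P setT \is a fin_num by exact: fin_num_measure.
pose X t w := h (U t w); pose Y n t w := h (Un n t w).
have XY2 n t : (X t \- Y n t)%R \in Lfun P 2%:E.
  apply: Lfun2_sqr_le (hB n t); apply: measurable_funB; first exact: measurable_fun_hU.
  exact: measurable_fun_hUn.
have Y0 t : Y 0%N t = cst (h 0) by apply/funext => w; rewrite /Y Umtrunc0.
have X2 t : X t \in Lfun P 2%:E.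
  rewrite (_ : X t = (X t \- Y 0%N t) + cst (h 0))%R; last first.
    by apply/funext => w; rewrite fctE /= Y0 /= subrK.
  by rewrite rpredD ?lee1n// => ?; exact: Lfun_cst.
have Y2 n t : Y n t \in Lfun P 2%:E.
  rewrite (_ : Y n t = X t - (X t \- Y n t))%R; last first.
    by apply/funext => w; rewrite !fctE /= opprB addrC subrK.
  by rewrite rpredB ?lee1n// => ?; exact: XY2.
pose b := Num.sqrt B.
have b0 : 0 <= b by exact: sqrtr_ge0.
have VXY n t : ('V_P[(X t \- Y n t)%R] <= ((b * rho ^+ n) ^+ 2)%:E)%E.
  by rewrite exprMn sqr_sqrtr//; apply: variance_le_sqr; [exact: XY2|exact: hB].
(* Truncation at lag 0 subtracts a constant, which does not change the variance. *)
have VX t : ('V_P[X t] <= (b ^+ 2)%:E)%E.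
  by have := VXY 0%N t; rewrite Y0 varianceB_cst_r// expr0 mulr1.
have decay t1 t2 : (t1 <= t2)%N ->
    `|fine (covariance P (X t1) (X t2))| <= 3 * B / rho ^+ m * rho ^+ (t2 - t1).
  move=> t12; have [mt|tm] := leqP m (t2 - t1).
    pose n := (t2 - t1 - m)%N.
    have -> : (t2 - t1 = n + m)%N by rewrite /n subnK.
    rewrite exprD [rho ^+ n * _]mulrC mulrA divfK ?gt_eqF ?exprn_gt0//.
    rewrite -[B]sqr_sqrtr//.
    apply: (covariance_approx_indep (X' := Y n t1) (Y' := Y n t2)) => //.
      by rewrite exprn_ge0 ?(ltW r0)// exprn_ile1// ltW.
    by apply: indep_hUn; rewrite /n; lia.
  (* At distance below [m] the windows may overlap; plain Cauchy-Schwarz is enough, since there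
     [rho ^+ (t2 - t1)] is at least [rho ^+ m]. *)
  apply: (@le_trans _ _ (b * b)); first exact: covariance_abs_le.
  rewrite -expr2 sqr_sqrtr// -mulrA.
  have k1 : 1 <= (rho ^+ m)^-1 * rho ^+ (t2 - t1).
    rewrite mulrC ler_pdivlMr ?exprn_gt0// mul1r.
    by apply: ler_wiXn2l; [exact: ltW|exact: ltW|exact: ltnW].
  by rewrite -mulrA; nra.
exists (3 * B / rho ^+ m); first by rewrite !mulr_ge0 ?invr_ge0 ?exprn_ge0// ltW.
move=> t1 t2; split; first exact: X2.
have [t12|t12] := leqP t1 t2.
  by have := decay _ _ t12; rewrite (_ : (t1 - t2)%N = 0%N) ?add0n//; lia.
rewrite covarianceC; have := decay _ _ (ltnW t12).
by rewrite (_ : (t2 - t1)%N = 0%N) ?addn0//; lia.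
Qed.

End moments.

(** * Consistency *)

Lemma sum_exp_dist_le (R : realType) (rho : R) n s : 0 <= rho < 1 ->
  \sum_(t < n) rho ^+ ((s - t) + (t - s)) <= 2 / (1 - rho).
Proof.
move=> rho01; have /andP[r0 r1] := rho01.
have r1' : 0 < 1 - rho by rewrite subr_gt0.
(* The times up to [s] and those after it contribute one geometric sum each. In the inductive step
   the term at time 0 is split off and the remaining ones shift both indices by one. *)
have H : forall s n, \sum_(t < n) rho ^+ ((s - t) + (t - s)) <=
    \sum_(i < s.+1) rho ^+ i + \sum_(i < n) rho ^+ i.
  elim=> [|s' IH] [|n'].
  - by rewrite !big_ord0 addr0 sumr_ge0// => i _; rewrite exprn_ge0.
  - rewrite [leLHS](_ : _ = \sum_(i < n'.+1) rho ^+ i); last first.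
      by apply: eq_bigr => i _; rewrite sub0n add0n subn0.
    by rewrite lerDr sumr_ge0// => i _; rewrite exprn_ge0.
  - by rewrite !big_ord0 addr0 sumr_ge0// => i _; rewrite exprn_ge0.
  - rewrite big_ord_recl /= subn0 addn0 [\sum_(i < s'.+2) _]big_ord_recr /=.
    have := IH n'; rewrite [\sum_(i < n'.+1) _]big_ord_recr /=.
    rewrite [\sum_(i < n') rho ^+ _](_ : _ =
      \sum_(t < n') rho ^+ (s'.+1 - bump 0 t + (bump 0 t - s'.+1))); last first.
      by apply: eq_bigr => i _; rewrite /bump leq0n add1n !subSS.
    have := exprn_ge0 n' r0; move: (_ ^+ n') (_ ^+ s'.+1) => x y.
    by move=> *; lra.
apply: le_trans (H _ _) _; rewrite ler_pdivlMr// mulrC mulrDr.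
have := geometric_sum_le s.+1 rho01; have := geometric_sum_le n rho01; lra.
Qed.

Lemma expectation_quad_form_le d (T : measurableType d) (R : realType)
    (P : probability T R) n (f : 'I_n -> T -> R) (G : 'M[R]_n) :
  (forall i, f i \in Lfun P 2%:E) ->
  (\int[P]_w (\sum_i \sum_j (f i w - fine 'E_P[f i]) * G i j * (f j w - fine 'E_P[f j]))%:E
   <= (\sum_i \sum_j `|G i j| * `|fine (covariance P (f i) (f j))|)%:E)%E.
Proof.
move=> f2.
have Pfin : P setT \is a fin_num by exact: fin_num_measure.
pose g i w := f i w - fine 'E_P[f i]%E.
have g2 i : g i \in Lfun P 2%:E.
  rewrite (_ : g i = f i - cst (fine 'E_P[f i]%E)) ?rpredB ?lee1n// => ?.
  exact: Lfun_cst.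
have ig i j : P.-integrable setT (fun w => (g i w * g j w)%:E).
  by have /Lfun1_integrable := Lfun2_mul_Lfun1 (g2 i) (g2 j).
have gE i j : (\int[P]_w (g i w * g j w)%:E)%E = covariance P (f i) (f j).
  rewrite covariance.unlock; transitivity ('E_P[(g i \* g j)%R])%E; last by [].
  by rewrite expectation.unlock.
under eq_integral do rewrite -sumEFin.
have iZ i j : P.-integrable setT (fun w =>
    ((f i w - fine 'E_P[f i]%E) * G i j * (f j w - fine 'E_P[f j]%E))%:E).
  have := integrableZl measurableT (G i j) (ig i j).
  apply: eq_integrable => // w _; rewrite -EFinM; congr (_%:E); rewrite /g; ring.
rewrite integral_sum//; last first.
  move=> i; under eq_fun do rewrite -sumEFin.
  by apply: integrable_sum => // j _.
rewrite -sumEFin; apply: lee_sum => i _.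
under eq_integral do rewrite -sumEFin.
rewrite integral_sum//.
rewrite -sumEFin; apply: lee_sum => j _.
rewrite (_ : (\int[P]_w _)%E = (G i j)%:E * covariance P (f i) (f j))%E.
  by rewrite (covariance_fineK (f2 i) (f2 j)) -EFinM lee_fin -normrM ler_norm.
rewrite -gE -integralZl//; apply: eq_integral => w _.
by rewrite -EFinM; congr (_%:E); rewrite /g; ring.
Qed.

Lemma markov_lt d (T : measurableType d) (R : realType) (P : probability T R)
    (Z : T -> R) (e B : R) : 0 < e -> measurable_fun setT Z -> (forall w, 0 <= Z w) ->
  (\int[P]_w (Z w)%:E <= B%:E)%E ->
  (P [set w | (e < Z w)%R] <= (B / e)%:E)%E.
Proof.
move=> e0 mZ Z0 ZB.
have mA : measurable [set w | (e < Z w)%R].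
  rewrite -[X in measurable X]setTI.
  have := @measurable_fun_ltr _ _ _ setT _ _ (measurable_cst e) mZ.
  by move/(_ measurableT [set true]) => /=; apply.
suff : (e%:E * P [set w | (e < Z w)%R] <= B%:E)%E.
  by rewrite EFinM -lee_pdivlMl// muleC.
apply: le_trans ZB.
rewrite -[X in (_ * P X)%E]setIT -integral_indic//.
rewrite -ge0_integralZl_EFin//; last 2 first.
- by apply/measurable_EFinP; exact: measurable_indic.
- exact: ltW.
apply: ge0_le_integral => //.
- by move=> w _; rewrite -EFinM lee_fin mulr_ge0// ltW.
- by apply/measurable_EFinP; apply: measurable_funM => //; exact: measurable_indic.
- exact/measurable_EFinP.
- move=> w _; rewrite -EFinM lee_fin indicE.
  have [wA|wA] := boolP (w \in _); last by rewrite mulr0.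
  by rewrite mulr1; move: wA; rewrite inE /= => /ltW.
Qed.

Lemma natr_ratio_cvg0 (R : realType) (p : nat -> nat) :
  (fun T : nat => (p T)%:R * ln (p T)%:R / T%:R) @ \oo --> (0 : R) ->
  (fun T : nat => (p T)%:R / T%:R) @ \oo --> (0 : R).
Proof.
move=> hp.
pose n0 := Num.ceil (expR 1 : R).
have n0P : expR 1 <= n0%:~R :> R by exact: ceil_ge.
have n00 : 0 <= n0%:~R :> R by apply: le_trans n0P; exact: expR_ge0.
(* Beyond [n0], the ceiling of the number e, the logarithm is at least 1; below it the constant
   suffices. *)
have hb (k : nat) : k%:R <= n0%:~R + k%:R * ln k%:R :> R.
  have [k0|k1] := leqP k 0.
    by move: k0; rewrite leqn0 => /eqP ->; rewrite mul0r addr0.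
  have lk0 : 0 <= ln k%:R :> R by rewrite ln_ge0// ler1n.
  have [kn|nk] := leP (k%:R : R) n0%:~R.
    by apply: le_trans kn _; rewrite lerDl mulr_ge0.
  have : 1 <= ln k%:R :> R.
    rewrite -[X in X <= _](@expRK R) ler_ln ?posrE ?expR_gt0 ?ltr0n//.
    exact: ltW (le_lt_trans n0P nk).
  have : 0 <= k%:R :> R by [].
  move: (k%:R : R) (ln _) => x y; nra.
have cn : (fun T : nat => n0%:~R / T%:R) @ \oo --> (0 : R).
  rewrite -[X in _ --> X](mulr0 (n0%:~R : R)); apply: cvgM; first exact: cvg_cst.
  by rewrite -(@cvg_shiftS R (fun n : nat => n%:R^-1 : R)); exact: cvg_harmonic.
apply: (@squeeze_cvgr _ _ _ _ (cst 0)
  (fun T : nat => n0%:~R / T%:R + (p T)%:R * ln (p T)%:R / T%:R)).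
- apply: nearW => T /=; rewrite divr_ge0//= -mulrDl ler_wpM2r//.
- exact: cvg_cst.
- by rewrite -[X in _ --> X](addr0 (0 : R)); exact: cvgD.
Qed.

Theorem theorem4 (R : realType) (dsp : measure_display) (Omega : measurableType dsp)
  (P : probability Omega R)
  (d q m L : nat)
  (eps u : 'I_L.+1 -> int -> 'I_d -> Omega -> R)
  (Sig Sroot : 'I_L.+1 -> int -> 'M[R]_d)
  (C : nat -> 'I_L.+1 -> 'M[R]_d)
  (phi : 'I_d -> 'I_L -> R) (r : 'I_L -> 'I_q -> R)
  (dist : ('I_q -> R) -> ('I_q -> R) -> R)
  (H : 'I_d -> 'M[R]_(d, m.+1) -> R)
  (s : nat -> 'I_q -> R)
  (p : nat -> nat)
  (X : forall T : nat, 'M[R]_(T, p T))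
  (beta : forall T : nat, 'cV[R]_(p T))
  (nu : 'I_d) :
  (* spatial locations, sites and the function d *)
  (forall t i, 0 <= s t i <= 1) ->
  (forall l i, 0 <= r l i <= 1) ->
  (forall a b : 'I_q -> R, (forall i, 0 <= a i <= 1) -> (forall i, 0 <= b i <= 1) ->
     0 <= dist a b <= 1) ->
  (* (E1) *)
  (forall l t k, measurable_fun setT (eps l t k)) ->
  (forall l t k, measurable_fun setT (u l t k)) ->
  mutually_indep_vecs P (fun lt : 'I_L.+1 * int => eps lt.1 lt.2) ->
  (forall l t k, P.-integrable setT (EFin \o eps l t k) /\ ('E_P[eps l t k] = 0)%E) ->
  (forall l t, posdef (Sig l t)) ->
  (forall l t, posdef (Sroot l t) /\ Sroot l t *m Sroot l t = Sig l t) ->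
  (forall l t k w, eps l t k w = \sum_(i < d) Sroot l t k i * u l t i w) ->
  (forall l t k, P.-integrable setT (EFin \o u l t k) /\ ('E_P[u l t k] = 0)%E) ->
  (forall l t, indep_coords P (u l t)) ->
  (* (E2) and (E7), with a common delta > 0 *)
  (exists delta : R, 0 < delta /\
     (exists M : R, forall l t k,
        (\int[P]_w ((`|eps l t k w| `^ (2 + delta))%:E) <= M%:E)%E) /\
     (exists LH : R, forall nu' (A B : 'M[R]_(d, m.+1)),
        `|H nu' A - H nu' B| <= LH * frob (A - B)) /\
     (exists Xi : 'I_d * 'I_m.+1 -> Omega -> R,
        (forall ik, measurable_fun setT (Xi ik)) /\
        indep_of_family P Xi
          (fun tsk : int * ('I_q -> R) * 'I_d =>
             Ufield eps C phi r dist tsk.1.1 tsk.1.2 tsk.2) /\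
        exists M : R, forall nu',
          (\int[P]_w ((`|H nu' (\matrix_(i < d, k < m.+1) Xi (i, k) w)| `^ (2 + delta))%:E)
             <= M%:E)%E)) ->
  (* (E3) *)
  (d = 1%N -> exists M : R, forall l t k,
     ('E_P[fun w => (eps l t k w ^+ 2)%R] <= M%:E)%E) ->
  (* (E4) *)
  (d = 1%N -> exists sig0 : R, 0 < sig0 /\ forall t k,
     ((sig0 ^+ 2)%:E <= 'E_P[fun w => (eps ord0 t k w ^+ 2)%R])%E) ->
  ((1 < d)%N -> exists lam : R, 0 < lam /\ forall t a,
     eigenvalue (Sig ord0 t) a -> lam <= a) ->
  (* (E5) *)
  (forall l k, exists pd : int -> R -> R,
     (forall t, measurable_fun setT (pd t)) /\ (forall t z, 0 <= pd t z) /\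
     (forall t (B : set R), measurable B ->
        P (eps l t k @^-1` B) = (\int[lebesgue_measure]_(z in B) (pd t z)%:E)%E) /\
     exists K : R, forall t (x : R),
       (\int[lebesgue_measure]_z ((`|pd t (z + x) - pd t z|)%:E) <= (K * `|x|)%:E)%E) ->
  (* (R) *)
  (exists K : R, forall T i j, `|X T i j| <= K) ->
  (exists (Sx : forall T : nat, 'M[R]_(p T)) (eta Cc a b : R),
     0 <= eta /\ 0 < a /\ a <= b /\
     forall T : nat, (0 < T)%N ->
       posdef (Sx T) /\
       spec_norm_le ((T%:R)^-1 *: ((X T)^T *m X T) - Sx T)
                    (Cc * ((p T)%:R `^ eta) / Num.sqrt T%:R) /\
       (forall a', eigenvalue ((T%:R)^-1 *: ((X T)^T *m X T)) a' -> a <= a' <= b)) ->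
  (* full rank design *)
  (forall T : nat, (0 < T)%N -> \rank (X T) = p T) ->
  (* geometric decay of the coefficients *)
  (exists (K rho : R), 0 <= rho < 1 /\
     forall j l i k, `|C j l i k| <= K * rho ^+ j) ->
  (* |x_tj eps_t^(nu')| <= 1 *)
  (forall (T : nat) (i : 'I_T) (j : 'I_(p T)) nu' w,
     `|X T i j * errobs P eps C phi r dist H s i.+1 nu' w| <= 1) ->
  (* growth conditions *)
  (fun T : nat => (p T)%:R * ln (p T)%:R / T%:R) @ \oo --> (0 : R) ->
  (fun T : nat => ln (T%:R) ^+ 2 / Num.sqrt (p T)%:R) @ \oo --> (0 : R) ->
  (* consistency of the OLS estimator for coordinate nu *)
  forall e : R, 0 < e ->
    (fun T : nat =>
       P [set w | e < norm2 (ols (X T)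
              (\col_(i < T) ((X T *m beta T) i 0 + errobs P eps C phi r dist H s i.+1 nu w))
              - beta T)]) @ \oo --> 0%E.
Proof.
move=> s01 r01 dist01 meps _ ind _ _ _ _ _ _ [delta [delta0 [[M hM] [[LH hLH] _]]]].
move=> _ _ _ _ [Kx hKx] [Sx [eta [Cc [a [b [_ [a0 [_ hR]]]]]]]] _ [K [rho [/andP[r0 r1] hC]]] _.
move=> hp _ e e0.
(* The decay lemma divides by a power of the rate, so the rate is raised to a positive one, still
   below 1. *)
pose rho' := Num.max rho 2^-1.
have rho'01 : 0 < rho' < 1.
  rewrite lt_max gt_max r1 (invr_gt0 (2 : R)) ltr0n orbT /=.
  by rewrite invf_lt1 ?ltr1n.
pose K' := `|K| + 1.
have K'0 : 0 < K' by rewrite ltr_wpDl.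
have hC' j l i k : `|C j l i k| <= K' * rho' ^+ j.
  apply: le_trans (hC j l i k) _; apply: (@le_trans _ _ (K' * rho ^+ j)).
    by rewrite ler_wpM2r ?exprn_ge0// ler_wpDr// ler_norm.
  rewrite ler_wpM2l ?(ltW K'0)// lerXn2r ?nnegrE//.
    by case/andP: rho'01 => /ltW.
  by rewrite le_max lexx.
pose M' := 1 + `|M|.
have M'0 : 0 <= M' by rewrite addr_ge0.
have hM' l t k : (\int[P]_w (eps l t k w ^+ 2)%:E <= M'%:E)%E.
  apply: (@le_trans _ _ (\int[P]_w (1 + (`|eps l t k w| `^ (2 + delta))%:E))%E).
    apply: ge0_le_integral => //.
    - by move=> w _; rewrite lee_fin sqr_ge0.
    - by apply/measurable_EFinP; apply: measurable_funX.
    - apply: emeasurable_funD => //; apply/measurable_EFinP.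
      by apply: (measurableT_comp (measurable_powR _)); exact: measurableT_comp.
    - by move=> w _; rewrite -EFinD lee_fin sqr_le_powR.
  rewrite ge0_integralD//; last first.
    apply/measurable_EFinP.
    by apply: (measurableT_comp (measurable_powR _)); exact: measurableT_comp.
  rewrite integral_cst//= probability_setT mule1 EFinD leeD2l//.
  by apply: le_trans (hM l t k) _; rewrite lee_fin ler_norm.
have dist01' t l : 0 <= dist (s t) (r l) <= 1 by exact: dist01.
have [B B0 hB] := hU_covariance_decay phi dist01' meps hM' M'0 K'0 rho'01 hC' (hLH nu) ind.
have rho'01' : 0 <= rho' < 1 by case/andP: rho'01 => /ltW -> ->.
have r'0 : 0 < 1 - rho' by case/andP: rho'01; rewrite subr_gt0.
pose f t w := H nu (Umat m eps C phi r dist s t w).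
pose err t w := f t w - fine 'E_P[f t]%E.
have f2 t : f t \in Lfun P 2%:E by have [] := hB t t.
have mf t : measurable_fun setT (f t).
  by have := f2 t; rewrite inE => /andP[/[!inE]].
have merr t : measurable_fun setT (err t) by apply: measurable_funB.
pose Q := Kx ^+ 2 * (B * (2 / (1 - rho'))).
pose kap := (a ^+ 2)^-1 * Q / e ^+ 2.
pose D T w := ols (X T) (\col_(i < T) ((X T *m beta T) i 0 + err i.+1 w)) - beta T.
have bound T : (0 < T)%N ->
    (P [set w | (e < norm2 (D T w))%R] <= (kap * ((p T)%:R / T%:R))%:E)%E.
  move=> T0; have TR0 : 0 < (T%:R : R) by rewrite ltr0n.
  have [_ [_ eigs]] := hR T T0.
  have -> : [set w | e < norm2 (D T w)] = [set w | e ^+ 2 < norm2 (D T w) ^+ 2].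
    by apply/seteqP; split => w /=; rewrite ltr_pXn2r ?nnegrE ?sqrtr_ge0// ltW.
  pose ev w : 'cV[R]_T := \col_(i < T) err i.+1 w.
  have Dle w : norm2 (D T w) ^+ 2 <= (a * T%:R)^-2 * norm2 ((X T)^T *m ev w) ^+ 2.
    rewrite /D (_ : \col_i _ = X T *m beta T + ev w); last first.
      by apply/matrixP => i j; rewrite !mxE ord1.
    by apply: ols_error_bound => // l /eigs /andP[].
  have mD : measurable_fun setT (fun w => norm2 (D T w) ^+ 2).
    under eq_fun do rewrite norm2_sqr dot_mxE.
    apply: measurable_sum => i; under eq_fun do rewrite -expr2.
    apply: measurable_funX; under eq_fun do rewrite mxE [X in X + _]mxE.
    apply: measurable_funD => //; apply: measurable_sum => j.
    apply: measurable_funM => //; under eq_fun do rewrite mxE.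
    by apply: measurable_funD.
  have nE w : norm2 ((X T)^T *m ev w) ^+ 2 =
      \sum_(i < T) \sum_(j < T) (f i.+1 w - fine 'E_P[f i.+1]%E) * (X T *m (X T)^T) i j *
        (f j.+1 w - fine 'E_P[f j.+1]%E).
    rewrite norm2_sqr trmx_mul trmxK mulmxA -(mulmxA _ (X T)) quad_formE.
    by apply: eq_bigr => i _; apply: eq_bigr => j _; rewrite !mxE.
  have := @expectation_quad_form_le _ _ _ P T (fun i : 'I_T => f i.+1)
    (X T *m (X T)^T) (fun i => f2 i.+1).
  under eq_integral do rewrite -nE.
  set S := \sum_i _ => intS.
  (* Each entry of [X X^T] is a sum of [p] products bounded by [Kx ^+ 2], and each row of
     covariances is at most [B] times a two-sided geometric sum. *)
  have SB : S <= (p T)%:R * T%:R * Q.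
    apply: (@le_trans _ _
      (\sum_(i < T) ((p T)%:R * Kx ^+ 2 * (B * (2 / (1 - rho')))))); last first.
      rewrite sumr_const card_ord -[leLHS]mulr_natl le_eqVlt; apply/orP; left.
      by apply/eqP; rewrite /Q; ring.
    apply: ler_sum => i _.
    apply: (@le_trans _ _
      (\sum_(j < T) ((p T)%:R * Kx ^+ 2) * (B * rho' ^+ ((i - j) + (j - i))))).
      apply: ler_sum => j _; apply: ler_pM => //.
        rewrite mxE; apply: le_trans (ler_norm_sum _ _ _) _.
        rewrite -[p T in leRHS]card_ord mulr_natl -sumr_const; apply: ler_sum => k _.
        by rewrite mxE normrM expr2 ler_pM.
      by have [_] := hB i.+1 j.+1; rewrite !subSS.
    rewrite -mulr_sumr ler_wpM2l//; first by apply: mulr_ge0 (sqr_ge0 _).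
    by rewrite -mulr_sumr ler_wpM2l// sum_exp_dist_le.
  have intD : (\int[P]_w (norm2 (D T w) ^+ 2)%:E <=
      ((a * T%:R)^-2 * ((p T)%:R * T%:R * Q))%:E)%E.
    have mZ : measurable_fun setT (fun w => norm2 ((X T)^T *m ev w) ^+ 2).
      under eq_fun do rewrite nE.
      apply: measurable_sum => i; apply: measurable_sum => j.
      apply: measurable_funM; last exact: merr.
      by apply: measurable_funM => //; exact: merr.
    have aT0 : 0 <= (a * T%:R)^-2 by rewrite invr_ge0 sqr_ge0.
    apply: (@le_trans _ _
      (\int[P]_w (((a * T%:R)^-2)%:E * (norm2 ((X T)^T *m ev w) ^+ 2)%:E))%E).
      apply: ge0_le_integral => //.
      - by move=> w _; rewrite lee_fin sqr_ge0.
      - exact/measurable_EFinP.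
      - by apply: measurable_funeM; exact/measurable_EFinP.
      - by move=> w _; rewrite -EFinM lee_fin.
    rewrite ge0_integralZl_EFin//; last 2 first.
    - by move=> w _; rewrite lee_fin sqr_ge0.
    - exact/measurable_EFinP.
    rewrite EFinM lee_wpmul2l ?lee_fin//; apply: le_trans intS _.
    by rewrite lee_fin.
  apply: le_trans (markov_lt (exprn_gt0 2 e0) mD _ intD) _; first by move=> w; rewrite sqr_ge0.
  rewrite lee_fin le_eqVlt; apply/orP; left; apply/eqP; rewrite /kap /Q.
  by field; rewrite ?gt_eqF.
apply: (@squeeze_cvge _ _ _ _ (fun=> 0%E) _ (fun T : nat => (kap * ((p T)%:R / T%:R))%:E)).
(* The bound is available from sample size 1 on, where division by T is meaningful. *)
- exists 1%N => // T T0; rewrite bound// andbT; exact: measure_ge0.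
- exact: cvg_cst.
- apply: cvg_EFin; first exact: nearW.
  by rewrite -[X in _ --> X](mulr0 kap); apply: cvgM; [exact: cvg_cst|exact: natr_ratio_cvg0].
Qed.
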